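(* Let $\mathfrak p\in\mathbb R[x,y,z]$ be a polynomial of total degree at most $3$ and let $\mathcal V(\nabla\mathfrak p)=\{(x,y,z)\in\mathbb R^3:\nabla\mathfrak p(x,y,z)=0\}$. There exists an algorithm computing a set $\widetilde{\mathcal V}_{\mathrm{aff}}(\nabla\mathfrak p)$ consisting of finitely many affine subspaces $\mathcal C\subset\mathcal V(\nabla\mathfrak p)$ such that $\mathcal V_{\mathrm{aff}}(\nabla\mathfrak p)\subset\widetilde{\mathcal V}_{\mathrm{aff}}(\nabla\mathfrak p)$.
   Context: $\mathcal V_{\mathrm{aff}}(\nabla\mathfrak p)$ is the set of affine subspaces $\mathcal C\subset\mathcal V(\nabla\mathfrak p)$ that are not properly contained in a connected component of $\mathcal V(\nabla\mathfrak p)$, i.e., the connected components of $\mathcal V(\nabla\mathfrak p)$ that are affine subspaces. Algorithms operate exactly on real numbers with real root finding of univariate polynomials as a primitive. *)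

(* Defs.v *)
From HB Require Import structures.
From mathcomp Require Import all_boot all_order all_algebra.
From mathcomp Require Import reals.
From mathcomp Require Import mpoly.

Set Implicit Arguments.
Unset Strict Implicit.
Unset Printing Implicit Defensive.

Import Order.TTheory GRing.Theory Num.Theory.
Local Open Scope ring_scope.

Section Geometry.
Variable R : realType.

Definition pt := 'rV[R]_3.

(* sup-norm distance (induces the Euclidean topology on R^3) *)
Definition dist3 (x y : pt) : R :=
  Num.max `|x ord0 0 - y ord0 0| (Num.max `|x ord0 1 - y ord0 1| `|x ord0 2%:R - y ord0 2%:R|).

Definition open_in (S A : pt -> Prop) : Prop :=
  forall x, A x -> S x /\ exists2 e : R, 0 < e &
    forall y, S y -> dist3 x y < e -> A y.

Definition connected3 (S : pt -> Prop) : Prop :=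
  ~ exists (A B : pt -> Prop),
      [/\ open_in S A, open_in S B, (exists x, A x), (exists x, B x) &
          (forall x, S x <-> (A x \/ B x)) /\ (forall x, ~ (A x /\ B x))].

Definition conn_component (V K : pt -> Prop) : Prop :=
  [/\ (forall x, K x -> V x), (exists x, K x), connected3 K &
      forall D : pt -> Prop, connected3 D -> (forall x, K x -> D x) ->
        (forall x, D x -> V x) -> forall x, D x -> K x].

Definition affine_span k (b : pt) (v : 'I_k -> pt) : pt -> Prop :=
  fun x => exists t : 'I_k -> R, x = b + \sum_(i < k) t i *: v i.

Definition affine_subspace (C : pt -> Prop) : Prop :=
  exists k (b : pt) (v : 'I_k -> pt), forall x, C x <-> affine_span b v x.

Definition peval (p : {mpoly R[3]}) (x : pt) : R := p.@[fun i => x ord0 i].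

Definition crit_set (p : {mpoly R[3]}) : pt -> Prop :=
  fun x => forall i : 'I_3, peval (p^`M(i)) x = 0.

Definition V_aff (p : {mpoly R[3]}) (C : pt -> Prop) : Prop :=
  [/\ affine_subspace C, (forall x, C x -> crit_set p x) &
      forall K, conn_component (crit_set p) K ->
        ~ ((forall x, C x -> K x) /\ exists x, K x /\ ~ C x)].

End Geometry.

(* Model of computation: a register machine operating exactly on real numbers *)
(* (Blum-Shub-Smale style, with arbitrary real machine constants), extended   *)
(* by a primitive for real root finding of univariate polynomials.           *)

Section Machine.
Variable R : realType.

Definition reg := nat.
Definition reg3 := (reg * reg * reg)%type.

Inductive cmd : Type :=
| CSkip
| CConst  (dst : reg) (c : R)
| CAdd    (dst a b : reg)
| CSub    (dst a b : reg)
| CMul    (dst a b : reg)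
| CDiv    (dst a b : reg)            (* a / b, with the convention x / 0 = 0 *)
| CNumRoots (dst : reg) (cs : seq reg)
    (* dst := number of distinct real roots of sum_i cs_i X^i (or -1 if this
       polynomial is zero) *)
| CRoot   (dst : reg) (cs : seq reg) (k : nat)
    (* dst := the k-th smallest (from 0) distinct real root of sum_i cs_i X^i
       if the polynomial is nonzero and has more than k real roots; else 0 *)
| CEmit   (b : reg3) (vs : seq reg3)
    (* output the affine subspace b + span(vs) *)
| CSeq    (c1 c2 : cmd)
| CIf     (a : reg) (c1 c2 : cmd)   (* if 0 < a then c1 else c2 *)
| CWhile  (a : reg) (c : cmd).      (* while 0 < a do c *)

Definition regs := nat -> R.
Definition out_item := ('rV[R]_3 * seq 'rV[R]_3)%type.
Definition mstate := (regs * seq out_item)%type.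

Definition upd (s : regs) (d : reg) (v : R) : regs :=
  fun i => if i == d then v else s i.

Definition vec_of (s : regs) (r : reg3) : 'rV[R]_3 :=
  let: (a, b, c) := r in \row_(i < 3) s (nth a [:: a; b; c] i).

Definition poly_of (s : regs) (cs : seq reg) : {poly R} :=
  \poly_(i < size cs) s (nth 0%N cs i).

Definition roots_below (q : {poly R}) (x : R) (l : seq R) : Prop :=
  sorted <%R l /\ forall y, y \in l <-> (root q y /\ y < x).

Definition all_roots (q : {poly R}) (l : seq R) : Prop :=
  sorted <%R l /\ forall y, y \in l <-> root q y.

Inductive exec : cmd -> mstate -> mstate -> Prop :=
| ESkip st : exec CSkip st st
| EConst s o d c : exec (CConst d c) (s, o) (upd s d c, o)
| EAdd s o d a b : exec (CAdd d a b) (s, o) (upd s d (s a + s b), o)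
| ESub s o d a b : exec (CSub d a b) (s, o) (upd s d (s a - s b), o)
| EMul s o d a b : exec (CMul d a b) (s, o) (upd s d (s a * s b), o)
| EDiv s o d a b : exec (CDiv d a b) (s, o) (upd s d (s a / s b), o)
| ENumRoots0 s o d cs : poly_of s cs = 0 ->
    exec (CNumRoots d cs) (s, o) (upd s d (-1), o)
| ENumRoots s o d cs l : poly_of s cs != 0 -> all_roots (poly_of s cs) l ->
    exec (CNumRoots d cs) (s, o) (upd s d (size l)%:R, o)
| ERoot s o d cs k x l : poly_of s cs != 0 -> root (poly_of s cs) x ->
    roots_below (poly_of s cs) x l -> size l = k ->
    exec (CRoot d cs k) (s, o) (upd s d x, o)
| ERootNone s o d cs k :
    ~ (poly_of s cs != 0 /\ exists x l, [/\ root (poly_of s cs) x,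
          roots_below (poly_of s cs) x l & size l = k]) ->
    exec (CRoot d cs k) (s, o) (upd s d 0, o)
| EEmit s o b vs :
    exec (CEmit b vs) (s, o) (s, rcons o (vec_of s b, map (vec_of s) vs))
| ESeq c1 c2 st1 st2 st3 : exec c1 st1 st2 -> exec c2 st2 st3 ->
    exec (CSeq c1 c2) st1 st3
| EIfT a c1 c2 s o st : 0 < s a -> exec c1 (s, o) st -> exec (CIf a c1 c2) (s, o) st
| EIfF a c1 c2 s o st : ~ (0 < s a) -> exec c2 (s, o) st -> exec (CIf a c1 c2) (s, o) st
| EWhileF a c s o : ~ (0 < s a) -> exec (CWhile a c) (s, o) (s, o)
| EWhileT a c s o st st' : 0 < s a -> exec c (s, o) st -> exec (CWhile a c) st st' ->
    exec (CWhile a c) (s, o) st'.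

Definition deg3_monoms : seq 'X_{1..3} :=
  map val (enum {: bmultinom 3 4}).

Definition input_regs (p : {mpoly R[3]}) : regs :=
  fun i => if (i < size deg3_monoms)%N
           then p@_(nth 0%MM deg3_monoms i) else 0.

Definition item_set (it : out_item) : 'rV[R]_3 -> Prop :=
  affine_span it.1 (fun i : 'I_(size it.2) => it.2`_i).

End Machine.

(* Main.v *)
(* A flat C in V_aff is a connected component of the critical set V.  Choose a
   set I of coordinates restricting to a chart C -> R^I, and look at the points of
   C whose chart coordinates are 0 or a basis vector: they span C, and each of
   them is the only point of C in the slice of V obtained by freezing the
   coordinates in I.  It is even isolated in this slice: otherwise curve selection
   yields a connected arc in V that meets C without being contained in C.

   The coordinates of isolated points of 0/1 slices form a countable set that is
   definable in terms of the coefficients of p.  By quantifier elimination it is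
   given by sign conditions on finitely many polynomials, and a point where none
   of the nonzero ones vanishes would come with a whole interval of points, which
   is uncountable.  So the machine computes all roots of these polynomials, forms
   all quadruples of points with coordinates among the roots, and emits the affine
   hulls lying in V, a condition that is again decided by quantifier elimination.

   Countability also replaces the monotonicity theorem in curve selection: a
   definable function of one variable has only countably many discontinuities,
   and a countable definable set is finite. *)
Require Import Defs.
From HB Require Import structures.
From mathcomp Require Import all_boot all_order all_algebra.
From mathcomp Require Import boolp classical_sets reals.
From mathcomp Require Import mpoly.
From mathcomp Require Import lra ring.
From mathcomp Require polyrcf ordered_qelim qe_rcf.

Set Implicit Arguments.
Unset Strict Implicit.
Unset Printing Implicit Defensive.

Import Order.TTheory GRing.Theory Num.Theory.
Local Open Scope ring_scope.

(** * Quantifier-free formulas and quantifier elimination *)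

Section Semialgebraic.
Variable R : realType.

Inductive tm :=
| TVar of nat | TCst of R | TAdd of tm & tm | TMul of tm & tm.

(** Strict positivity is the only atom because it is the only test of the machine; equality and the
    other order relations are Boolean combinations. *)
Inductive fm := FPos of tm | FNot of fm | FAnd of fm & fm.

Implicit Types (e : nat -> R) (t : tm) (f : fm).

Fixpoint teval e t : R :=
  match t with
  | TVar n => e n
  | TCst c => c
  | TAdd a b => teval e a + teval e b
  | TMul a b => teval e a * teval e b
  end.

Fixpoint sat e f : bool :=
  match f with
  | FPos t => 0 < teval e t
  | FNot f => ~~ sat e f
  | FAnd f g => sat e f && sat e g
  end.

Definition scons (x : R) e : nat -> R := fun i => if i is j.+1 then e j else x.

Fixpoint tsub (h : nat -> tm) t : tm :=
  match t with
  | TVar n => h n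
  | TCst c => TCst c
  | TAdd a b => TAdd (tsub h a) (tsub h b)
  | TMul a b => TMul (tsub h a) (tsub h b)
  end.

Fixpoint fsub (h : nat -> tm) f : fm :=
  match f with
  | FPos t => FPos (tsub h t)
  | FNot f => FNot (fsub h f)
  | FAnd f g => FAnd (fsub h f) (fsub h g)
  end.

Lemma teval_sub e h t : teval e (tsub h t) = teval (fun i => teval e (h i)) t.
Proof. by elim: t => //= a -> b ->. Qed.

Lemma sat_sub e h f : sat e (fsub h f) = sat (fun i => teval e (h i)) f.
Proof. by elim: f => /= [t|f ->|f -> g ->] //; rewrite teval_sub. Qed.

Fixpoint gterm t : GRing.term R :=
  match t with
  | TVar n => GRing.Var R n
  | TCst c => GRing.Const c
  | TAdd a b => GRing.Add (gterm a) (gterm b)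
  | TMul a b => GRing.Mul (gterm a) (gterm b)
  end.

Fixpoint oform f : ordered_qelim.ord.formula R :=
  match f with
  | FPos t => ordered_qelim.ord.Lt (GRing.Const 0) (gterm t)
  | FNot f => ordered_qelim.ord.Not (oform f)
  | FAnd f g => ordered_qelim.ord.And (oform f) (oform g)
  end.

(** The default branches here and in [of_oform] hold junk for inverses, unit tests and quantifiers;
    [rterm], [rformula] and [qf_form] exclude these. *)
Fixpoint of_gterm (t : GRing.term R) : tm :=
  match t with
  | GRing.Var n => TVar n
  | GRing.Const c => TCst c
  | GRing.NatConst n => TCst n%:R
  | GRing.Add a b => TAdd (of_gterm a) (of_gterm b)
  | GRing.Opp a => TMul (TCst (-1)) (of_gterm a)
  | GRing.NatMul a n => TMul (TCst n%:R) (of_gterm a)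
  | GRing.Mul a b => TMul (of_gterm a) (of_gterm b)
  | GRing.Exp a n => iter n (TMul (of_gterm a)) (TCst 1)
  | _ => TCst 0
  end.

Definition FLt a b := FPos (TAdd b (TMul (TCst (-1)) a)).
Definition FOr f g := FNot (FAnd (FNot f) (FNot g)).

Fixpoint of_oform (f : ordered_qelim.ord.formula R) : fm :=
  match f with
  | ordered_qelim.ord.Bool b => FPos (TCst b%:R)
  | ordered_qelim.ord.Equal a b => FAnd (FNot (FLt (of_gterm a) (of_gterm b)))
                                       (FNot (FLt (of_gterm b) (of_gterm a)))
  | ordered_qelim.ord.Lt a b => FLt (of_gterm a) (of_gterm b)
  | ordered_qelim.ord.Le a b => FNot (FLt (of_gterm b) (of_gterm a))
  | ordered_qelim.ord.And f g => FAnd (of_oform f) (of_oform g)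
  | ordered_qelim.ord.Or f g => FOr (of_oform f) (of_oform g)
  | ordered_qelim.ord.Implies f g => FOr (FNot (of_oform f)) (of_oform g)
  | ordered_qelim.ord.Not f => FNot (of_oform f)
  | _ => FPos (TCst 0)
  end.

Lemma of_gtermP (s : seq R) (t : GRing.term R) : GRing.rterm t ->
  teval (nth 0 s) (of_gterm t) = GRing.eval s t.
Proof.
elim: t => //=.
- by move=> a IHa b IHb /andP[/IHa-> /IHb->].
- by move=> a IHa /IHa->; rewrite mulN1r.
- by move=> a IHa n /IHa->; rewrite mulr_natl.
- by move=> a IHa b IHb /andP[/IHa-> /IHb->].
- by move=> a IHa n /IHa <-; elim: n => //= n ->; rewrite exprS.
Qed.

Lemma sat_FLt e a b : sat e (FLt a b) = (teval e a < teval e b).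
Proof. by rewrite /= mulN1r subr_gt0. Qed.

Lemma of_oformP (s : seq R) (f' : ordered_qelim.ord.formula R) : ordered_qelim.ord.qf_form f' ->
  ordered_qelim.ord.rformula f' ->
  sat (nth 0 s) (of_oform f') = ordered_qelim.ord.qf_eval s f'.
Proof.
elim: f' => //=.
- by case=> _ _; rewrite ?ltr01 ?ltxx.
- move=> a b _ /andP[/(of_gtermP s) ha /(of_gtermP s) hb].
  by rewrite ha hb !mulN1r !subr_gt0 -!leNgt eq_le andbC.
- move=> a b _ /andP[/(of_gtermP s) ha /(of_gtermP s) hb].
  by rewrite ha hb !mulN1r !subr_gt0.
- move=> a b _ /andP[/(of_gtermP s) ha /(of_gtermP s) hb].
  by rewrite ha hb !mulN1r !subr_gt0 -leNgt.
- by move=> f IHf g IHg /andP[/IHf{}IHf /IHg{}IHg] /andP[/IHf-> /IHg->].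
- move=> f IHf g IHg /andP[/IHf{}IHf /IHg{}IHg] /andP[/IHf-> /IHg->].
  by rewrite negb_and !negbK.
- move=> f IHf g IHg /andP[/IHf{}IHf /IHg{}IHg] /andP[/IHf-> /IHg->].
  by rewrite negb_and !negbK implybE.
- by move=> f IHf /IHf{}IHf /IHf->.
Qed.

Lemma rterm_gterm t : GRing.rterm (gterm t).
Proof. by elim: t => //= a -> b ->. Qed.

Lemma rformula_oform f : ordered_qelim.ord.rformula (oform f).
Proof. by elim: f => /= [t|f ->|f -> g ->] //; rewrite rterm_gterm. Qed.

Lemma eval_gterm (s : seq R) t : GRing.eval s (gterm t) = teval (nth 0 s) t.
Proof. by elim: t => //= a -> b ->. Qed.

Lemma holds_oform (s : seq R) f :
  ordered_qelim.ord.holds s (oform f) <-> sat (nth 0 s) f.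
Proof.
elim: f => /= [t|f IHf|f IHf g IHg]; first by rewrite eval_gterm.
- by split=> [h|/negP h]; [apply/negP => /IHf|move=> /IHf].
- by split=> [[/IHf-> /IHg->]|/andP[/IHf ? /IHg]].
Qed.

Fixpoint tbound t : nat :=
  match t with
  | TVar n => n.+1
  | TCst _ => 0
  | TAdd a b | TMul a b => maxn (tbound a) (tbound b)
  end.

Fixpoint fbound f : nat :=
  match f with
  | FPos t => tbound t
  | FNot f => fbound f
  | FAnd f g => maxn (fbound f) (fbound g)
  end.

Lemma teval_bound e e' t : (forall i, (i < tbound t)%N -> e i = e' i) ->
  teval e t = teval e' t.
Proof.
elim: t => //= [n h|a IHa b IHb h|a IHa b IHb h]; first exact: h.
  by rewrite IHa ?IHb // => i hi; apply: h; rewrite leq_max hi ?orbT.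
by rewrite IHa ?IHb // => i hi; apply: h; rewrite leq_max hi ?orbT.
Qed.

Lemma sat_bound e e' f : (forall i, (i < fbound f)%N -> e i = e' i) ->
  sat e f = sat e' f.
Proof.
elim: f => /= [t h|f IHf h|f IHf g IHg h]; first by rewrite (teval_bound h).
  by rewrite IHf.
by rewrite IHf ?IHg // => i hi; apply: h; rewrite leq_max hi ?orbT.
Qed.

(** Quantifier elimination over real closed fields, transported from list environments to functions:
    by [sat_bound] only finitely many variables matter. *)
Lemma fm_exists f : exists g, forall e, sat e g <-> exists x, sat (scons x e) f.
Proof.
pose N := fbound f.
pose F := ordered_qelim.ord.Exists 0 (oform f).
have rF : ordered_qelim.ord.rformula F by exact: rformula_oform.
pose wproj i bc : ordered_qelim.ord.formula R :=
  qe_rcf.qfr_to_formula (qe_rcf.wproj i bc).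
pose G := ordered_qelim.ord.quantifier_elim wproj F.
have /andP[qG rG] : ordered_qelim.ord.qf_form G && ordered_qelim.ord.rformula G.
  exact: (ordered_qelim.ord.quantifier_elim_wf (@qe_rcf.wf_QE_wproj R)).
(* Shift the variables down past the eliminated one. The constants 0 mirror the dummy head of
   [0 :: s] and the default value of [nth] past its end. *)
pose h i := if i is j.+1 then (if (j < N)%N then TVar j else TCst 0) else TCst 0.
exists (fsub h (of_oform G)) => e.
pose s := mkseq e N.
have nth_s j : (j < N)%N -> nth 0 s j = e j by move=> jN; rewrite nth_mkseq.
have -> : sat e (fsub h (of_oform G)) = sat (nth 0 (0 :: s)) (of_oform G).
  rewrite sat_sub; congr sat; apply: funext => -[|j] //=.
  by case: ltnP => jN /=; [rewrite nth_s|rewrite nth_default ?size_mkseq].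
rewrite of_oformP //.
have P := ordered_qelim.ord.quantifier_elim_rformP
  (@qe_rcf.wf_QE_wproj R) (@qe_rcf.valid_QE_wproj R) (0 :: s) rF.
have sat_s x : sat (nth 0 (x :: s)) f = sat (scons x e) f.
  apply: sat_bound => -[|j] //= jN; apply: nth_s; exact: ltnW.
split=> [/P[x /holds_oform]|[x hx]]; first by rewrite sat_s; exists x.
by apply/P; exists x; apply/holds_oform; rewrite sat_s.
Qed.

End Semialgebraic.

(** * Semialgebraic predicates and o-minimality *)

Section Definable.
Variable R : realType.
Implicit Types (e : nat -> R).

(** Semialgebraic sets with arbitrary real parameters, in finitely many coordinates of the
    environment; [PF] is the class of polynomial functions. *)
Definition SA (P : (nat -> R) -> Prop) := exists f : fm R, forall e, P e <-> sat e f.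
Definition PF (g : (nat -> R) -> R) := exists t : tm R, forall e, g e = teval e t.

Lemma SA_ext (P Q : (nat -> R) -> Prop) : (forall e, P e <-> Q e) -> SA Q -> SA P.
Proof. by move=> PQ [f hf]; exists f => e; rewrite PQ. Qed.

Lemma SA_not P : SA P -> SA (fun e => ~ P e).
Proof.
move=> [f hf]; exists (FNot f) => e /=.
by split=> [/hf h|/negP h /hf //]; apply/negP.
Qed.

Lemma SA_and P Q : SA P -> SA Q -> SA (fun e => P e /\ Q e).
Proof.
move=> [f hf] [g hg]; exists (FAnd f g) => e /=.
by split=> [[/hf-> /hg->]|/andP[/hf ? /hg]].
Qed.

Lemma SA_or P Q : SA P -> SA Q -> SA (fun e => P e \/ Q e).
Proof.
move=> sP sQ; apply: (@SA_ext _ (fun e => ~ (~ P e /\ ~ Q e))) => [e|].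
  by case: (pselect (P e)); case: (pselect (Q e)); tauto.
by apply: SA_not; apply: SA_and; apply: SA_not.
Qed.

Lemma SA_imp P Q : SA P -> SA Q -> SA (fun e => P e -> Q e).
Proof.
move=> sP sQ; apply: (@SA_ext _ (fun e => ~ P e \/ Q e)) => [e|].
  by case: (pselect (P e)); tauto.
by apply: SA_or => //; apply: SA_not.
Qed.

Lemma SA_ex (P : (nat -> R) -> R -> Prop) :
  SA (fun e => P (fun i => e i.+1) (e 0%N)) -> SA (fun e => exists x, P e x).
Proof.
move=> [f hf]; have [g hg] := fm_exists f; exists g => e.
by rewrite hg; split=> -[x hx]; exists x; [exact/(hf (scons x e))|
  exact/(hf (scons x e))].
Qed.

Lemma SA_all (P : (nat -> R) -> R -> Prop) :
  SA (fun e => P (fun i => e i.+1) (e 0%N)) -> SA (fun e => forall x, P e x).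
Proof.
move=> sP; apply: (@SA_ext _ (fun e => ~ exists x, ~ P e x)) => [e|].
  by rewrite -forallNP; split=> h x; [move/(_ (h x))|exact: contrapT].
apply: SA_not; exact/SA_ex/SA_not.
Qed.

Lemma SA_lt g h : PF g -> PF h -> SA (fun e => g e < h e).
Proof.
by move=> [a ha] [b hb]; exists (FLt a b) => e; rewrite sat_FLt ha hb.
Qed.

Lemma SA_le g h : PF g -> PF h -> SA (fun e => g e <= h e).
Proof.
move=> pg ph; apply: (@SA_ext _ (fun e => ~ (h e < g e))) => [e|].
  by rewrite leNgt; split=> [/negP|/negP].
by apply: SA_not; apply: SA_lt.
Qed.

Lemma SA_eq g h : PF g -> PF h -> SA (fun e => g e = h e).
Proof.
move=> pg ph; apply: (@SA_ext _ (fun e => g e <= h e /\ h e <= g e)) => [e|].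
  by split=> [->|[h1 h2]]; [rewrite !lexx|apply/le_anti; rewrite h1 h2].
by apply: SA_and; apply: SA_le.
Qed.

Lemma PF_cst c : PF (fun=> c).
Proof. by exists (TCst c). Qed.

Lemma PF_var i : PF (fun e => e i).
Proof. by exists (TVar R i). Qed.

Lemma PF_add g h : PF g -> PF h -> PF (fun e => g e + h e).
Proof. by move=> [a ha] [b hb]; exists (TAdd a b) => e; rewrite ha hb. Qed.

Lemma PF_mul g h : PF g -> PF h -> PF (fun e => g e * h e).
Proof. by move=> [a ha] [b hb]; exists (TMul a b) => e; rewrite ha hb. Qed.

Lemma PF_opp g : PF g -> PF (fun e => - g e).
Proof. by move=> [a ha]; exists (TMul (TCst (-1)) a) => e; rewrite /= mulN1r ha. Qed.

Lemma PF_exp g n : PF g -> PF (fun e => g e ^+ n).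
Proof.
move=> pg; elim: n => [|n [t ht]]; first exact: PF_cst.
have [a ha] := pg; exists (TMul a t) => e; by rewrite exprS /= -ht -ha.
Qed.

Lemma PF_sum (I : Type) (s : seq I) (g : I -> (nat -> R) -> R) :
  (forall i, PF (g i)) -> PF (fun e => \sum_(i <- s) g i e).
Proof.
move=> pg; elim: s => [|i s [t ht]].
  by exists (TCst 0) => e; rewrite big_nil.
by have [a ha] := pg i; exists (TAdd a t) => e; rewrite big_cons /= ha ht.
Qed.

Lemma SA_comp P (g : nat -> (nat -> R) -> R) :
  SA P -> (forall i, PF (g i)) -> SA (fun e => P (fun i => g i e)).
Proof.
move=> [f hf] /choice[h hh]; exists (fsub h f) => e.
rewrite hf sat_sub; suff -> : (fun i => g i e) = fun i => teval e (h i) by [].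
by apply: funext => i; rewrite hh.
Qed.

Definition def1 (P : R -> Prop) := SA (fun e => P (e 0%N)).
Definition def2 (P : R -> R -> Prop) := SA (fun e => P (e 0%N) (e 1%N)).
Definition def3 (P : R -> R -> R -> Prop) :=
  SA (fun e => P (e 0%N) (e 1%N) (e 2%N)).

Lemma SA_app1 P a : def1 P -> PF a -> SA (fun e => P (a e)).
Proof. by move=> dP pa; apply: (SA_comp (g := fun _ => a) dP). Qed.

Lemma SA_app2 P a b : def2 P -> PF a -> PF b -> SA (fun e => P (a e) (b e)).
Proof.
move=> dP pa pb; apply: (SA_comp (g := nth b [:: a]) dP) => -[|[|i]] //=.
Qed.

Lemma SA_app3 P a b c : def3 P -> PF a -> PF b -> PF c ->
  SA (fun e => P (a e) (b e) (c e)).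
Proof.
move=> dP pa pb pc; apply: (SA_comp (g := nth c [:: a; b]) dP).
by move=> -[|[|[|i]]] //=.
Qed.

End Definable.

(** Follows the syntax of a first-order description. What it cannot decompose is left to the caller,
    as in [sa_V], which then applies [dV]. *)
Ltac sa := cbv beta; first
  [ assumption
  | refine (PF_cst _)
  | refine (PF_var _ _)
  | (refine (PF_add _ _); sa)
  | (refine (PF_mul _ _); sa)
  | (refine (PF_opp _); sa)
  | (refine (PF_exp _ _); sa)
  | (refine (SA_and _ _); sa)
  | (refine (SA_or _ _); sa)
  | (refine (SA_not _); sa)
  | (refine (SA_ex _); sa)
  | (refine (SA_lt _ _); sa)
  | (refine (SA_le _ _); sa)
  | (refine (SA_eq _ _); sa)
  | (eapply SA_app1; [eassumption|sa])
  | (eapply SA_app2; [eassumption|sa|sa])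
  | (eapply SA_app3; [eassumption|sa|sa|sa])
  | (refine (SA_imp _ _); sa)
  | (refine (SA_all _); sa)
  | idtac ].

(** * Definable subsets of the line: one-sided germs and countability *)

Section OneVariable.
Variable R : realType.
Implicit Types (e : nat -> R) (f : fm R) (t : tm R).

(* Variable 0 is the indeterminate; [e] evaluates the others, shifted by one. *)
Fixpoint tpoly e t : {poly R} :=
  match t with
  | TVar n => if n is j.+1 then (e j)%:P else 'X
  | TCst c => c%:P
  | TAdd a b => tpoly e a + tpoly e b
  | TMul a b => tpoly e a * tpoly e b
  end.

Lemma horner_tpoly e t x : (tpoly e t).[x] = teval (scons x e) t.
Proof.
elim: t => /= [[|n]|c|a <- b <-|a <- b <-]; rewrite ?hornerE //.
Qed.

Fixpoint atoms f : seq (tm R) :=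
  match f with
  | FPos t => [:: t]
  | FNot f => atoms f
  | FAnd f g => atoms f ++ atoms g
  end.

(** A nonzero polynomial keeps its sign up to its next root after [t], the search being capped at
    [t + 1]. *)
Lemma poly_sign_right (q : {poly R}) (t : R) : exists2 d, 0 < d &
  exists b, forall s, t < s < t + d -> (0 < q.[s]) = b.
Proof.
have [->|q0] := eqVneq q 0.
  by exists 1 => //; exists false => s _; rewrite horner0 ltxx.
have tt1 : t < t + 1 by rewrite ltrDl.
pose r := polyrcf.next_root q t (t + 1).
exists (r - t); first by rewrite subr_gt0 polyrcf.next_root_gt.
exists (0 < polyrcf.sgp_right q t) => s; rewrite subrKC => ts.
by rewrite -sgr_gt0 (@polyrcf.sgr_neighpr _ (t + 1) q t s).
Qed.

Lemma fm_sign_right f e (t : R) : exists2 d, 0 < d &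
  exists b, forall s, t < s < t + d -> sat (scons s e) f = b.
Proof.
elim: f => /= [u|f [d d0 [b h]]|f [d d0 [b h]] g [d' d0' [b' h']]].
- have [d d0 [b h]] := poly_sign_right (tpoly e u) t.
  by exists d => //; exists b => s /h; rewrite horner_tpoly.
- by exists d => //; exists (~~ b) => s /h->.
- exists (Num.min d d'); first by rewrite lt_min d0.
  exists (b && b') => s /andP[ts]; rewrite -ltrBlDl lt_min !ltrBlDl => /andP[? ?].
  by rewrite h ?h' ?ts.
Qed.

(** This dichotomy of germs is the form in which o-minimality is used below. *)
Lemma def1_right (P : R -> Prop) (t : R) : def1 P -> exists2 d, 0 < d &
  (forall s, t < s < t + d -> P s) \/ (forall s, t < s < t + d -> ~ P s).
Proof.
move=> [f hf]; have [d d0 [b h]] := fm_sign_right f (fun=> 0) t.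
exists d => //; case: b h => h; [left|right] => s /h.
  by move/(hf (scons s (fun=> 0))).
by move=> + /(hf (scons s (fun=> 0))); move=> ->.
Qed.

Lemma def1_left (P : R -> Prop) (t : R) : def1 P -> exists2 d, 0 < d &
  (forall s, t - d < s < t -> P s) \/ (forall s, t - d < s < t -> ~ P s).
Proof.
move=> dP; have dP' : def1 (fun s => P (- s)) by rewrite /def1; sa.
have [d d0 h] := def1_right (- t) dP'; exists d => //.
by case: h => h; [left|right] => s /andP[h1 h2]; have := h (- s);
  rewrite opprK; apply; apply/andP; split; lra.
Qed.

Definition is_atom_root e u t := (tpoly e t != 0) && root (tpoly e t) u.

(** An identically zero atom is false everywhere, and an atom not vanishing at [u] keeps its sign
    nearby by continuity. So truth can change only at roots of the nonzero atoms. *)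
Lemma fm_locally_constant f e u : ~~ has (is_atom_root e u) (atoms f) ->
  exists2 d, 0 < d & forall s, `|s - u| < d ->
    sat (scons s e) f = sat (scons u e) f.
Proof.
elim: f => /= [t|f IHf /IHf[d d0 h]|f IHf g IHg].
- rewrite orbF negb_and negbK /is_atom_root -horner_tpoly.
  have [q0 _|ht /= ru] := eqVneq (tpoly e t) 0.
    by exists 1 => // s _; rewrite -horner_tpoly q0 !horner0.
  have qu : 0 < `|(tpoly e t).[u]| by rewrite normr_gt0.
  have [d d0 hd] := @polyrcf.poly_cont _ u (tpoly e t) _ qu.
  exists d => // s /hd; rewrite -horner_tpoly.
  move: (_.[s]) (_.[u]) qu => a b; rewrite normr_gt0 => b0 hab.
  move: hab; rewrite ltr_norml => /andP[].
  case: (ltrgtP 0 b) b0 => // b0 _; [rewrite gtr0_norm|rewrite ltr0_norm] => //.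
    by move=> h1 h2; apply/idP; lra.
  by move=> h1 h2; apply/negbTE; rewrite -leNgt; lra.
- by exists d => // s /h->.
rewrite has_cat negb_or => /andP[/IHf[d d0 h] /IHg[d' d0' h']].
exists (Num.min d d'); first by rewrite lt_min d0.
by move=> s; rewrite lt_min => /andP[/h-> /h'->].
Qed.

Lemma real_lub (E : R -> Prop) B : (exists x, E x) -> (forall x, E x -> x <= B) ->
  exists m, (forall x, E x -> x <= m) /\ forall y, y < m -> exists2 x, E x & y < x.
Proof.
move=> [x0 Ex0] EB; exists (sup E); split.
  by apply/ubP/ub_le_sup; exists B; apply/ubP.
move=> y yE; have [||x Ex] := @sup_adherent R E (sup E - y).
- by rewrite subr_gt0.
- by split; [exists x0|exists B; apply/ubP].
- by rewrite subKr => ?; exists x.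
Qed.

(** Countability through a relation rather than a function: a point may have many codes, such as all
    rationals in some interval, and none need be chosen. *)
Definition countably_coded (D : R -> Prop) := exists (K : countType)
  (code : R -> K -> Prop), (forall u, D u -> exists k, code u k) /\
  forall u v k, D u -> D v -> code u k -> code v k -> u = v.

(* Cantor's argument: nested intervals, the [n]-th avoiding the [n]-th point. *)
Lemma coded_no_interval (D : R -> Prop) a b : countably_coded D -> a < b ->
  exists2 u, a < u < b & ~ D u.
Proof.
move=> [K [code [ex inj]]] ab; apply: contrapT => h.
have {h} abD u : a < u < b -> D u.
  by move=> hu; apply: contrapT => nD; apply: h; exists u.
(* [g n] is the point of [D] having a code of number [n], and 0 if there is none. *)
have /choice[g hg] : forall n : nat, exists x : R, forall u k,
    D u -> code u k -> pickle k = n -> x = u.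
  move=> n; case: (pselect (exists u k, [/\ D u, code u k & pickle k = n])).
    move=> [u [k [Du uk <-]]]; exists u => v k' Dv vk'.
    by move=> /(pcan_inj pickleK) kk; apply: (inj _ _ k) => //; rewrite -kk.
  by move=> h; exists 0 => u k Du uk kn; case: h; exists u, k.
(* Keep the closed outer third on the other side of the midpoint from [g n]. The start is the middle
   third, so that the limit lies strictly between [a] and [b]. *)
pose step (n : nat) (I : R * R) := if g n < (I.1 + I.2) / 2
  then ((I.1 + 2 * I.2) / 3, I.2) else (I.1, (2 * I.1 + I.2) / 3).
pose I := fix I n := if n is m.+1 then step m (I m)
  else ((2 * a + b) / 3, (a + 2 * b) / 3).
have IE n : I n.+1 = step n (I n) by [].
have I0 : I 0 = ((2 * a + b) / 3, (a + 2 * b) / 3) by [].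
move: I IE I0 => I IE I0.
have Ilt n : (I n).1 < (I n).2.
  elim: n => [|n ih]; first by rewrite I0 /=; lra.
  by rewrite IE /step; case: ifP => /= _; lra.
have IS n : (I n).1 <= (I n.+1).1 /\ (I n.+1).2 <= (I n).2.
  by have := Ilt n; rewrite IE /step; case: ifP => /= _ ?; split; lra.
have Im m n : (m <= n)%N -> (I m).1 <= (I n).1 /\ (I n).2 <= (I m).2.
  elim: n => [|n ih]; first by rewrite leqn0 => /eqP->.
  rewrite leq_eqVlt => /orP[/eqP->//|/ih[h1 h2]]; have [h3 h4] := IS n.
  by split; [apply: le_trans h3|apply: le_trans h2].
have Imn m n : (I m).1 <= (I n).2.
  have [h1 _] := Im _ _ (leq_maxl m n); have [_ h2] := Im _ _ (leq_maxr m n).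
  by apply: (le_trans h1); apply: le_trans h2; apply: ltW.
have [||u [uub ulub]] := @real_lub (fun x => exists n, x = (I n).1) (I 0).2.
- by exists (I 0).1, 0.
- by move=> x [n ->].
have Iu n : (I n).1 <= u <= (I n).2.
  rewrite uub; last by exists n.
  rewrite leNgt; apply/negP => /ulub[x [m ->]]; by rewrite ltNge Imn.
have abu : a < u < b by have := Iu 0; rewrite I0 /=; lra.
have [k uk] := ex u (abD _ abu).
have := hg _ _ _ (abD _ abu) uk erefl; set n := pickle k => gu.
have := Iu n.+1; have := Ilt n; have := Iu n; rewrite IE /step gu.
by case: ifP => /=; lra.
Qed.

(** Otherwise [def1_right] puts a whole interval inside [D], which is countable. *)
Lemma coded_eventually_not (D : R -> Prop) (t : R) : countably_coded D -> def1 D ->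
  exists2 d, 0 < d & forall s, t < s < t + d -> ~ D s.
Proof.
move=> cD dD; have [d d0 [h|h]] := def1_right t dD; last by exists d.
have [|u hu []] := @coded_no_interval D t (t + d) cD; first by rewrite ltrDl.
exact: h.
Qed.

End OneVariable.

(** * Definable functions and curve selection *)

Section DefinableFunctions.
Variable R : realType.

Definition continuous_point (f : R -> R) (t : R) := forall n, 0 < n ->
  exists2 d, 0 < d & forall s, `|s - t| < d -> `|f s - f t| < n.

Section Graph.
Variables (f : R -> R) (G : R -> R -> Prop).
Hypotheses (dG : def2 G) (Gf : forall t y, G t y <-> y = f t).

Let G_f t : G t (f t). Proof. exact/Gf. Qed.

(** Discontinuity of [f] at [t], phrased through the graph and without absolute values so that it is
    visibly first-order. *)
Definition jump (t : R) := exists n, 0 < n /\ forall d, 0 < d ->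
  exists s, (t - d < s /\ s < t + d) /\
  exists y, exists z, G s y /\ G t z /\ (z + n <= y \/ y + n <= z).

Lemma def1_jump : def1 jump.
Proof. by rewrite /def1 /jump; sa. Qed.

Lemma not_jump_continuous t : ~ jump t -> continuous_point f t.
Proof.
move=> nj n n0; apply: contrapT => h; apply: nj; exists n; split=> // d d0.
apply: contrapT => h'; apply: h; exists d => // s; rewrite ltr_norml => hs.
rewrite ltNge; apply/negP => hn; apply: h'; exists s; split; first by split; lra.
exists (f s), (f t); do 2!split => //.
by move: hn; rewrite ler_normr => /orP[h1|h1]; [left|right]; lra.
Qed.

Lemma def1_level y : def1 (fun s => y <= f s) /\ def1 (fun s => f s <= y).
Proof.
split; [apply: (@SA_ext _ _ (fun e => exists z, G (e 0%N) z /\ y <= z))|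
        apply: (@SA_ext _ _ (fun e => exists z, G (e 0%N) z /\ z <= y))].
- by move=> e; split=> [h|[z [/Gf->]]//]; exists (f (e 0%N)).
- by sa.
- by move=> e; split=> [h|[z [/Gf->]]//]; exists (f (e 0%N)).
- by sa.
Qed.

Lemma rat_between (x y : R) : x < y -> exists q : rat, x < ratr q < y.
Proof. by move=> /rat_in_itvoo[q]; rewrite in_itv; exists q. Qed.

(* At a jump, by o-minimality some rational [y] separates [f t] from the values
   of [f] on a one-sided neighbourhood of [t], which we cut at a rational [r]. *)
Lemma coded_jump : countably_coded jump.
Proof.
pose lo (b : bool) u v : bool := if b then u < v :> R else v < u.
pose code t (k : bool * bool * rat * rat) := let: (b, d, y, r) := k in
  lo b (f t) (ratr y) /\
  if d then t < ratr r /\ forall s, t < s < ratr r -> ~~ lo b (f s) (ratr y)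
  else ratr r < t /\ forall s, ratr r < s < t -> ~~ lo b (f s) (ratr y).
exists (bool * bool * rat * rat)%type, code; split; last first.
  (* Of two distinct points with the same code, one lies in the one-sided interval of the other,
     where [f] is on the wrong side of [y]. *)
  move=> u v [[[b d] y] r] _ _ /= [lu hu] [lv hv].
  case: (ltgtP u v) => // uv; exfalso; case: d hu hv => -[h1 h2] [h3 h4].
  - by move: lv; apply/negP/h2; rewrite uv.
  - by move: lu; apply/negP/h4; rewrite h1.
  - by move: lu; apply/negP/h4; rewrite uv.
  - by move: lv; apply/negP/h2; rewrite h3.
move=> t [n [n0 hn]]; apply: contrapT => nc.
have {}nc b d y r : ~ code t (b, d, y, r) by move=> h; apply: nc; exists (b, d, y, r).
have [y1 /andP[y1l y1u]] : exists q : rat, f t < ratr q < f t + n.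
  by apply: rat_between; lra.
have [y2 /andP[y2l y2u]] : exists q : rat, f t - n < ratr q < f t.
  by apply: rat_between; lra.
(* Since [t] has no code, a strict inequality between [f t] and a rational persists to the right of
   [t], and likewise to the left. *)
have right b y : lo b (f t) (ratr y) -> exists2 d, 0 < d &
    forall s, t < s < t + d -> lo b (f s) (ratr y).
  move=> lt.
  have dP : def1 (fun s => ~~ lo b (f s) (ratr y)).
    have [h1 h2] := def1_level (ratr y); case: (b).
      by apply: SA_ext h1 => e; rewrite /= leNgt.
    by apply: SA_ext h2 => e; rewrite /= leNgt.
  have [d d0 [h|h]] := def1_right t dP; last first.
    by exists d => // s /h /negP; rewrite negbK.
  have [r /andP[r1 r2]] : exists q : rat, t < ratr q < t + d.
    by apply: rat_between; lra.
  case: (nc b true y r); split=> //; split=> // s /andP[s1 s2].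
  by apply: h; rewrite s1 (lt_trans s2).
have left b y : lo b (f t) (ratr y) -> exists2 d, 0 < d &
    forall s, t - d < s < t -> lo b (f s) (ratr y).
  move=> lt.
  have dP : def1 (fun s => ~~ lo b (f s) (ratr y)).
    have [h1 h2] := def1_level (ratr y); case: (b).
      by apply: SA_ext h1 => e; rewrite /= leNgt.
    by apply: SA_ext h2 => e; rewrite /= leNgt.
  have [d d0 [h|h]] := def1_left t dP; last first.
    by exists d => // s /h /negP; rewrite negbK.
  have [r /andP[r1 r2]] : exists q : rat, t - d < ratr q < t.
    by apply: rat_between; lra.
  case: (nc b false y r); split=> //; split=> // s /andP[s1 s2].
  by apply: h; rewrite s2 (lt_trans r1).
(* Hence near [t] all values lie between [y2] and [y1], within [n] of [f t], which refutes the
   jump. *)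
have [d1 d10 h1] := right true y1 y1l; have [d2 d20 h2] := right false y2 y2u.
have [d3 d30 h3] := left true y1 y1l; have [d4 d40 h4] := left false y2 y2u.
pose d := Num.min (Num.min d1 d2) (Num.min d3 d4).
have d0 : 0 < d by rewrite !lt_min d10 d20 d30.
have [s [[ts st] [y [z [/Gf-> [/Gf->]]]]]] := hn d d0.
have : d <= d1 /\ d <= d2 by rewrite !ge_min !lexx !orbT.
have : d <= d3 /\ d <= d4 by rewrite !ge_min !lexx !orbT.
move: d d0 ts st => d d0 ts st [e3 e4] [e1 e2].
case: (ltgtP t s) => [lts|lst|->]; last by lra.
- have /h1 /= : t < s < t + d1 by lra.
  have /h2 /= : t < s < t + d2 by lra.
  by lra.
- have /h3 /= : t - d3 < s < t by lra.
  have /h4 /= : t - d4 < s < t by lra.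
  by lra.
Qed.

Lemma definable_continuous_right t0 : exists2 d, 0 < d &
  forall t, t0 < t < t0 + d -> continuous_point f t.
Proof.
have [d d0 h] := coded_eventually_not t0 coded_jump def1_jump.
by exists d => // t /h; apply: not_jump_continuous.
Qed.

End Graph.

Lemma real_glb (E : R -> Prop) B : (exists x, E x) -> (forall x, E x -> B <= x) ->
  exists m, (forall x, E x -> m <= x) /\ forall y, m < y -> exists2 x, E x & x < y.
Proof.
move=> [x0 Ex0] EB.
have [||m [h1 h2]] := @real_lub R (fun x => E (- x)) (- B).
- by exists (- x0); rewrite opprK.
- by move=> x /EB; lra.
exists (- m); split=> [x Ex|y my].
  by have := h1 (- x); rewrite opprK => /(_ Ex); lra.
by have [|x Ex yx] := h2 (- y); [lra|exists (- x) => //; lra].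
Qed.

(* The chosen point is the least element of the fibre or, failing that, the
   midpoint of the longest interval of the fibre starting at its infimum. *)
Definition canonical (A : R -> R -> Prop) (t y : R) : Prop :=
  (A t y /\ forall z, A t z -> y <= z) \/
  exists m, exists M, (forall z, A t z -> m < z) /\ m < M /\
    (forall z, m < z -> z < M -> A t z) /\
    (forall N, M < N -> exists z, m < z /\ z < N /\ ~ A t z) /\ y + y = m + M.

Lemma canonical_mem A t y : canonical A t y -> A t y.
Proof.
case=> [[//]|[m [M [_ [mM [h [_ yE]]]]]]].
by apply: h; lra.
Qed.

(** The least element, the infimum [m] and the right end [M] are each determined by the fibre, and
    [aux] shows that the two cases exclude each other. *)
Lemma canonical_unique A t y y' : canonical A t y -> canonical A t y' -> y = y'.
Proof.
have between (u v w : R) : u < v -> u < w -> exists2 z, u < z & z < v /\ z < w.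
  move=> uv uw; exists ((u + Num.min v w) / 2).
    have : u < Num.min v w by rewrite lt_min uv.
    by lra.
  have : Num.min v w <= v /\ Num.min v w <= w by rewrite !ge_min !lexx orbT.
  have : u < Num.min v w by rewrite lt_min uv.
  by move=> ? [? ?]; split; lra.
have aux x m M : A t x -> (forall z, A t z -> x <= z) ->
    (forall z, A t z -> m < z) -> m < M -> (forall z, m < z -> z < M -> A t z) -> False.
  move=> Ax xA mA mM h; have [z mz [zx zM]] := between _ _ _ (mA x Ax) mM.
  by have := xA z (h _ mz zM); lra.
have inf_eq m M n : (forall z, A t z -> n < z) -> m < M ->
    (forall z, m < z -> z < M -> A t z) -> n <= m.
  move=> nA mM h; rewrite leNgt; apply/negP => mn.
  have [z mz [zn zM]] := between _ _ _ mn mM.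
  by have := nA z (h _ mz zM); lra.
have sup_eq m M N : (forall N, M < N -> exists z, m < z /\ z < N /\ ~ A t z) ->
    (forall z, m < z -> z < N -> A t z) -> N <= M.
  move=> h1 h2; rewrite leNgt; apply/negP => /h1[z [mz [zN]]]; apply.
  exact: h2.
case=> [[Ay yA]|[m [M [mA [mM [hM [hN yE]]]]]]];
  case=> [[Ay' yA']|[m' [M' [mA' [mM' [hM' [hN' yE']]]]]]].
- by apply/le_anti; rewrite yA // yA'.
- by case: (aux y m' M').
- by case: (aux y' m M).
have mm : m = m'.
  by apply/le_anti; rewrite (inf_eq m' M' m) // (inf_eq m M m').
subst m'.
have MM : M = M'.
  by apply/le_anti; rewrite (sup_eq m M' M) // (sup_eq m M M').
by rewrite MM in yE; lra.
Qed.

Lemma def1_section (A : R -> R -> Prop) t : def2 A -> def1 (A t).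
Proof. by move=> dA; rewrite /def1; sa. Qed.

Lemma canonical_exists (A : R -> R -> Prop) t B : def2 A -> (forall y, A t y -> - B <= y <= B) ->
  (exists y, A t y) -> exists y, canonical A t y.
Proof.
move=> dA AB exA.
have [|m [mA mub]] := @real_glb (A t) (- B) exA.
  by move=> x /AB/andP[].
case: (pselect (A t m)) => [Am|nAm]; first by exists m; left.
have {}mA z : A t z -> m < z.
  by move=> Az; rewrite lt_neqAle mA // andbT; apply/eqP => mz; apply: nAm; rewrite mz.
(* The fibre cannot avoid a right neighbourhood of its infimum, so it contains one. *)
have [d d0 [h|h]] := def1_right m (def1_section t dA); last first.
  have [|x Ax xmd] := mub (m + d); first by lra.
  by case: (h x) => //; rewrite mA.
pose E M := m < M /\ forall z, m < z -> z < M -> A t z.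
have Emd : E (m + d).
  by split; [lra|move=> z z1 z2; apply: h; rewrite z1].
have [||M [EM Mlub]] := @real_lub R E B; first by exists (m + d).
  (* An interval reaching beyond [B] would put the point [(B + M) / 2] of the fibre above its
     bound. *)
  move=> M [mM hM]; rewrite leNgt; apply/negP => BM.
  have [x0 Ax0] := exA; have mx0 := mA _ Ax0; have /andP[_ x0B] := AB _ Ax0.
  by have /AB : A t ((B + M) / 2) by [apply: hM; lra]; lra.
have mM : m < M by have := EM _ Emd; lra.
exists ((m + M) / 2); right; exists m, M; do ![split=> //]; last by lra.
  by move=> z mz /Mlub[N [_ hN] zN]; apply: hN.
move=> N MN; apply: contrapT => hN.
have /EM : E N; last by lra.
split=> [|z mz zN]; first by lra.
by apply: contrapT => nA; apply: hN; exists z.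
Qed.

(** The canonical point is unique and first-order in [A], so the function selecting it has a
    definable graph. *)
Lemma definable_choice (A : R -> R -> Prop) B : def2 A -> (forall t y, A t y -> - B <= y <= B) ->
  exists f, def2 (fun t y => y = f t) /\ forall t, (exists y, A t y) -> A t (f t).
Proof.
move=> dA AB.
(* The default value 0 makes the selection total. *)
pose C t y := canonical A t y \/ (~ exists z, canonical A t z) /\ y = 0.
have dC0 : def2 (canonical A) by rewrite /def2 /canonical; sa.
have dC : def2 C by rewrite /def2 /C; sa.
have /choice[f hf] : forall t, exists y, C t y.
  move=> t; case: (pselect (exists z, canonical A t z)) => [[z hz]|h].
    by exists z; left.
  by exists 0; right.
exists f; split=> [|t exA].
  apply: SA_ext dC => e; split=> [->//|].
  case: (hf (e 0%N)) => [h1|[h1 ->]] [h2|[h2 ->]] //.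
  - exact: canonical_unique h2 h1.
  - by case: h2; exists (f (e 0%N)).
  - by case: h1; exists (e 1%N).
apply: canonical_mem; case: (hf t) => // -[]; case.
exact: canonical_exists dA (AB t) exA.
Qed.

(** * Curve selection at an accumulation point *)

Section CurveSelection.
Variables (S : R -> R -> R -> Prop) (a b c : R).
Hypothesis dS : def3 S.

Definition sqd (x y z : R) := (x - a) ^+ 2 + (y - b) ^+ 2 + (z - c) ^+ 2.

Hypothesis accu : forall d, 0 < d ->
  exists x, exists y, exists z, S x y z /\ 0 < sqd x y z < d.

(** The arc is parametrised by its squared distance to the base point. Its coordinates are chosen
    one after the other, each with the earlier ones fixed, and each is continuous on some interval
    starting at 0. *)
Lemma curve_selection : exists2 d, 0 < d & exists f1, exists f2, exists f3,
  forall t, 0 < t < d ->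
    [/\ S (f1 t) (f2 t) (f3 t), sqd (f1 t) (f2 t) (f3 t) = t &
        [/\ continuous_point f1 t, continuous_point f2 t & continuous_point f3 t]].
Proof.
(* The condition [t < 1] bounds the fibres, as [definable_choice] requires. *)
pose Q t x y z := (S x y z /\ (x - a) ^+ 2 + (y - b) ^+ 2 + (z - c) ^+ 2 = t) /\
  t < 1.
have Qbound t x y z : Q t x y z ->
    (x - a) ^+ 2 < 1 /\ (y - b) ^+ 2 < 1 /\ (z - c) ^+ 2 < 1.
  move=> [[_ <-]].
  have := sqr_ge0 (x - a); have := sqr_ge0 (y - b); have := sqr_ge0 (z - c).
  by move=> ? ? ? ?; do !split; lra.
have bound (x u : R) : (x - u) ^+ 2 < 1 -> - (`|u| + 1) <= x <= `|u| + 1.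
  move=> h; have : u <= `|u| /\ - u <= `|u| by rewrite !ler_normr !lexx orbT.
  by nra.
have [f1 [df1 hf1]] : exists f, def2 (fun t y => y = f t) /\ forall t,
    (exists x, exists y, exists z, Q t x y z) -> exists y, exists z, Q t (f t) y z.
  apply: (@definable_choice (fun t x => exists y, exists z, Q t x y z) (`|a| + 1)).
    by rewrite /def2 /Q; sa.
  by move=> t x [y [z /Qbound[h _]]]; apply: bound.
(* Named so that [clearbody] leaves an opaque relation, which [sa] handles through [dG1]. *)
pose G1 t y := y = f1 t.
have dG1 : def2 G1 by [].
have G1f t y : G1 t y <-> y = f1 t by [].
have [f2 [df2 hf2]] : exists f, def2 (fun t y => y = f t) /\ forall t,
    (exists y, exists x, G1 t x /\ exists z, Q t x y z) ->
    exists x, G1 t x /\ exists z, Q t x (f t) z.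
  apply: (@definable_choice (fun t y => exists x, G1 t x /\ exists z, Q t x y z)
    (`|b| + 1)).
    by clearbody G1; rewrite /def2 /Q; sa.
  by move=> t y [x [_ [z /Qbound[_ [h _]]]]]; apply: bound.
pose G2 t y := y = f2 t.
have dG2 : def2 G2 by [].
have G2f t y : G2 t y <-> y = f2 t by [].
have [f3 [df3 hf3]] : exists f, def2 (fun t y => y = f t) /\ forall t,
    (exists z, exists x, G1 t x /\ exists y, G2 t y /\ Q t x y z) ->
    exists x, G1 t x /\ exists y, G2 t y /\ Q t x y (f t).
  apply: (@definable_choice
    (fun t z => exists x, G1 t x /\ exists y, G2 t y /\ Q t x y z) (`|c| + 1)).
    by clearbody G1 G2; rewrite /def2 /Q; sa.
  by move=> t z [x [_ [y [_ /Qbound[_ [_ h]]]]]]; apply: bound.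
have dE : def1 (fun t => exists x, exists y, exists z, Q t x y z).
  by rewrite /def1 /Q; sa.
(* Either all small positive squared distances are attained on [S] or none is; accumulation excludes
   the latter. *)
have [d d0 [hd|hd]] := def1_right 0 dE; last first.
  have [|x [y [z [Sxyz /andP[h1 h2]]]]] := @accu (Num.min d 1).
    by rewrite lt_min d0 ltr01.
  move: h2; rewrite lt_min => /andP[h2 h3].
  by case: (hd (sqd x y z)); [rewrite add0r h1|exists x, y, z].
have [d1 d10 c1] := definable_continuous_right df1 (fun t y => iff_refl _) 0.
have [d2 d20 c2] := definable_continuous_right df2 (fun t y => iff_refl _) 0.
have [d3 d30 c3] := definable_continuous_right df3 (fun t y => iff_refl _) 0.
exists (Num.min (Num.min d d1) (Num.min d2 d3)); first by rewrite !lt_min d0 d10 d20.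
exists f1, f2, f3 => t; rewrite !lt_min => /andP[t0 /andP[/andP[td td1] /andP[td2 td3]]].
have ex1 := hf1 t (hd t _); rewrite add0r t0 in ex1.
have [y [z Q1]] := ex1 td.
have [|x [-> [z' Q2]]] := hf2 t; first by exists y, (f1 t); split=> //; exists z.
have [|x' [-> [y' [-> Q3]]]] := hf3 t.
  by exists z', (f1 t); split=> //; exists (f2 t).
have [[S3 q3] _] := Q3; split=> //.
by split; [apply: c1|apply: c2|apply: c3]; rewrite add0r t0.
Qed.

End CurveSelection.

End DefinableFunctions.

(** * Connected sets *)

Section Connectedness.
Variable R : realType.
Notation pt := 'rV[R]_3.
Implicit Types (x y : pt).

Lemma dist3_lt x y (d : R) : dist3 x y < d <->
  [/\ `|x ord0 0 - y ord0 0| < d, `|x ord0 1 - y ord0 1| < d &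
      `|x ord0 2%:R - y ord0 2%:R| < d].
Proof.
rewrite /dist3 !gt_max; split; first by case/and3P.
by move=> [-> -> ->].
Qed.

Lemma dist3_refl x (d : R) : 0 < d -> dist3 x x < d.
Proof. by move=> d0; apply/dist3_lt; rewrite !subrr normr0. Qed.

Definition interval_like (I : R -> Prop) :=
  forall r t s, I r -> I t -> r <= s <= t -> I s.

Definition continuous_on (I : R -> Prop) (g : R -> pt) := forall t, I t ->
  forall n, 0 < n -> exists2 d, 0 < d &
    forall s, I s -> `|s - t| < d -> dist3 (g t) (g s) < n.

Lemma connected_image (I : R -> Prop) (g : R -> pt) :
  interval_like I -> continuous_on I g -> connected3 (fun x => exists t, I t /\ x = g t).
Proof.
move=> Iconv gc; set D := fun x => _.
have Dg t : I t -> D (g t) by move=> It; exists t.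
suff aux (A B : pt -> Prop) t1 t2 : open_in D A -> open_in D B ->
    (forall x, D x -> A x \/ B x) -> (forall x, ~ (A x /\ B x)) ->
    I t1 -> I t2 -> A (g t1) -> B (g t2) -> t1 < t2 -> False.
  move=> [A [B [oA oB [x Ax] [y By] [cov dis]]]].
  have [[t1 [It1 x1]] _] := oA x Ax; have [[t2 [It2 y2]] _] := oB y By.
  have cAB z : D z -> A z \/ B z by move/cov.
  rewrite x1 in Ax; rewrite y2 in By.
  case: (ltgtP t1 t2) => t12; first exact: (aux A B t1 t2).
    apply: (aux B A t2 t1) => // z; first by move/cAB; tauto.
    by have := dis z; tauto.
  by apply: (dis (g t1)); split=> //; rewrite t12.
move=> oA oB cov dis It1 It2 A1 B2 t12.
(* The supremum [m] of [E] has its image neither in [A], as [E] would then extend beyond [m] or [A]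
   would meet [B] at [t2], nor in [B], which would then meet [A] just before [m]. *)
pose E t := t1 <= t <= t2 /\ forall s, t1 <= s <= t -> A (g s).
have E1 : E t1.
  split=> [|s]; first by rewrite lexx ltW.
  by move=> ?; have -> : s = t1 by apply/le_anti; rewrite andbC.
have [||m [Em mub]] := @real_lub R E t2; first by exists t1.
  by move=> t [/andP[]].
have t1m : t1 <= m by exact: Em.
have mt2 : m <= t2.
  by rewrite leNgt; apply/negP => /mub[t [/andP[_ h] _]]; rewrite ltNge h.
have Im : I m by apply: (Iconv t1 t2); rewrite ?t1m.
case: (cov _ (Dg _ Im)) => hm.
  have [_ [n n0 hA]] := oA _ hm; have [d d0 hd] := gc m Im n n0.
  have [m2|] := eqVneq m t2; first by apply: (dis (g m)); split=> //; rewrite m2.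
  move=> mt2n; have {mt2n}mt2 : m < t2 by rewrite lt_neqAle mt2n.
  pose m' := Num.min (m + d / 2) t2.
  have mm' : m < m' by rewrite lt_min mt2 andbT; lra.
  have m't2 : m' <= t2 by rewrite ge_min lexx orbT.
  have m'd : m' <= m + d / 2 by rewrite ge_min lexx.
  have : E m'; last by move/Em; lra.
  split=> [|s /andP[s1 s2]]; first by rewrite m't2 andbT; lra.
  have [sm|ms] := ltP s m.
    by have [t [_ ht] st] := mub s sm; apply: ht; rewrite s1 ltW.
  have Is : I s by apply: (Iconv t1 t2) => //; rewrite s1 (le_trans s2).
  apply: hA; first exact: Dg.
  by apply: hd => //; rewrite ger0_norm; lra.
have [_ [n n0 hB]] := oB _ hm; have [d d0 hd] := gc m Im n n0.
have [t [ht htA] mt] := mub (m - d) ltac:(lra).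
have tm : t <= m by apply: Em.
have It : I t by apply: (Iconv t1 t2).
apply: (dis (g t)); split.
  by apply: htA; case/andP: ht => ->; rewrite lexx.
by apply: hB; [apply: Dg|apply: hd => //; rewrite ler0_norm; lra].
Qed.

(** A separation of [S] restricts to a separation of the piece joining [x0] to a point on the other
    side. *)
Lemma connected_join (S : pt -> Prop) (x0 : pt) :
  (forall x, S x -> exists D, [/\ connected3 D, D x0, D x & forall y, D y -> S y]) ->
  connected3 S.
Proof.
move=> hS [A [B [oA oB [a Aa] [b Bb] [cov dis]]]].
have restr (A' D : pt -> Prop) : open_in S A' -> (forall y, D y -> S y) ->
    open_in D (fun x => A' x /\ D x).
  move=> oA' DS x [/oA'[_ [d d0 hd]] Dx]; split=> //; exists d => // y Dy xy.
  by split=> //; apply: hd => //; apply: DS.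
have sep (D : pt -> Prop) x y : connected3 D -> (forall y, D y -> S y) ->
    D x -> D y -> A x -> B y -> False.
  move=> cD DS Dx Dy Ax By; apply: cD.
  exists (fun x => A x /\ D x), (fun x => B x /\ D x); split; [| |by exists x|by exists y|].
  - exact: restr.
  - exact: restr.
  split=> [z|z [[? _] [? _]]]; last exact: (dis z).
  by split=> [Dz|]; [have /cov := DS z Dz; tauto|tauto].
have [Sa _] := oA _ Aa; have [Sb _] := oB _ Bb.
have [D [cD D0 Da DS]] := hS a Sa; have [D' [cD' D0' Db DS']] := hS b Sb.
have /cov[h0|h0] := DS _ D0; first exact: (sep D' x0 b).
exact: (sep D a x0).
Qed.

Lemma connected_segment x y :
  connected3 (fun z => exists t, (0 <= t <= 1) /\ z = x + t *: (y - x)).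
Proof.
apply: connected_image => [r t s /andP[r0 _] /andP[_ t1] /andP[rs st]|t _ n n0].
  by rewrite (le_trans r0) // (le_trans st).
(* A Lipschitz constant of the parametrisation; the summand 1 makes it positive. *)
pose k := `|(y - x) ord0 0| + `|(y - x) ord0 1| + `|(y - x) ord0 2%:R| + 1.
have k0 : 0 < k.
  rewrite /k; have := normr_ge0 ((y - x) ord0 0); have := normr_ge0 ((y - x) ord0 1).
  by have := normr_ge0 ((y - x) ord0 2%:R); lra.
exists (n / k); first exact: divr_gt0.
move=> s _; rewrite ltr_pdivlMr // => hs.
have bound (i : 'I_3) : `|(y - x) ord0 i| <= k ->
    `|(x + t *: (y - x)) ord0 i - (x + s *: (y - x)) ord0 i| < n.
  move=> ik; apply: le_lt_trans hs.
  have -> : (x + t *: (y - x)) ord0 i - (x + s *: (y - x)) ord0 i =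
      - ((s - t) * (y - x) ord0 i) by rewrite !mxE; ring.
  by rewrite normrN normrM ler_wpM2l.
have := normr_ge0 ((y - x) ord0 0); have := normr_ge0 ((y - x) ord0 1).
have := normr_ge0 ((y - x) ord0 2%:R) => h2 h1 h0.
by apply/dist3_lt; split; apply: bound; rewrite /k; lra.
Qed.

Lemma connected_affine_span k (b : pt) (v : 'I_k -> pt) : connected3 (affine_span b v).
Proof.
have span_b : affine_span b v b.
  by exists (fun=> 0); rewrite big1 ?addr0 // => i _; rewrite scale0r.
apply: (@connected_join _ b) => x [t ->].
exists (fun z => exists s, (0 <= s <= 1) /\ z = b + s *: (b + \sum_(i < k) t i *: v i - b)).
split; first exact: connected_segment.
- by exists 0; rewrite lexx ler01 scale0r addr0.
- by exists 1; rewrite lexx ler01 scale1r [b + _ - b]addrAC subrr add0r.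
move=> y [s [_ ->]]; exists (fun i => s * t i).
rewrite addrAC subrr add0r scaler_sumr; congr (_ + _).
by apply: eq_bigr => i _; rewrite scalerA.
Qed.

(* A component that is an affine subspace swallows every connected subset of
   the critical set that it meets. *)
Lemma V_aff_absorb (p : {mpoly R[3]}) (C D : pt -> Prop) : V_aff p C ->
  connected3 D -> (forall x, D x -> crit_set p x) -> (exists x, C x /\ D x) ->
  forall x, D x -> C x.
Proof.
move=> [[k [b [v Cspan]]] CV nC] cD DV [x0 [Cx0 Dx0]] x Dx; apply: contrapT => nCx.
(* [K] is the component of [x0] in the critical set. It contains [C] and also [x], so it would
   contain [C] properly. *)
pose K z := exists D' : pt -> Prop,
  [/\ connected3 D', (forall y, D' y -> crit_set p y), D' x0 & D' z].
have DK D' z : connected3 D' -> (forall y, D' y -> crit_set p y) -> D' x0 ->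
  D' z -> K z by exists D'.
have cC : connected3 C.
  by have -> : C = affine_span b v
    by [apply: funext => z; apply/propext; exact: Cspan]; exact: connected_affine_span.
apply: (nC K).
  split.
  - by move=> z [D' [_ DV' _ /DV']].
  - by exists x0; apply: (DK D).
  - apply: (@connected_join _ x0) => z [D' [cD' DV' D0 Dz]].
    by exists D'; split=> // y; apply: DK.
  - by move=> D' cD' KD' DV' y D'y; apply: (DK D') => //; apply: KD'; apply: (DK D).
split=> [z Cz|]; first exact: (DK C).
by exists x; split=> //; apply: (DK D).
Qed.

End Connectedness.

(** * Affine components and isolated points of slices *)

Section Frame.
Variable R : realType.
Notation pt := 'rV[R]_3.

Definition bit (c : R) := c = 0 \/ c = 1.

(* The coordinates selected by [s] form a chart of [C] that sends [x] to a
   vertex of the unit cube. *)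
Definition chart_vertex (C : pt -> Prop) (s : pred 'I_3) (x : pt) :=
  [/\ C x, forall j, s j -> bit (x ord0 j) &
      forall y, C y -> (forall j, s j -> y ord0 j = x ord0 j) -> y = x].

Lemma affine_frame (C : pt -> Prop) : affine_subspace C ->
  exists (s : pred 'I_3) (b0 : pt) (b : 'I_3 -> pt),
    [/\ forall x, C x <-> affine_span b0 (fun i => b i - b0) x,
        chart_vertex C s b0 & forall i, chart_vertex C s (b i)].
Proof.
move=> [k [b [v hC]]].
pose M : 'M[R]_(k, 3) := \matrix_i v i.
have CM x : C x <-> (x - b <= M)%MS.
  rewrite hC; split=> [[t ->]|/submxP[t ht]].
    apply/submxP; exists (\row_i t i); rewrite addrAC subrr add0r mulmx_sum_row.
    by apply: eq_bigr => i _; rewrite mxE rowK.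
  exists (fun i => t ord0 i); rewrite -[LHS](subrK b) ht addrC mulmx_sum_row.
  by congr (_ + _); apply: eq_bigr => i _; rewrite rowK.
pose N := row_base M; set r := \rank M in N.
have Nfull : row_full N^T by rewrite /row_full mxrank_tr; exact: row_base_free.
(* [f] selects independent columns of the direction basis [N]. [W] is this basis normalised to the
   identity on them, and [b0] the point of [C] whose selected coordinates vanish. *)
pose f : 'I_r -> 'I_3 := fullrankfun Nfull.
have uN : colsub f N \in unitmx.
  have -> : colsub f N = (rowsub f N^T)^T by apply/matrixP => i j; rewrite !mxE.
  by rewrite unitmx_tr; exact: fullrowsub_unit.
pose W := invmx (colsub f N) *m N.
have Wf : colsub f W = 1%:M by rewrite -mulmx_colsub mulVmx.
have WM : (W :=: M)%MS.
  apply: eqmx_trans (eq_row_base M); apply: eqmxMfull.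
  by rewrite row_full_unit unitmx_inv.
pose b0 := b - colsub f b *m W.
have mulWf (u : 'rV_r) j : (u *m W) ord0 (f j) = u ord0 j.
  have -> : (u *m W) ord0 (f j) = colsub f (u *m W) ord0 j by rewrite [RHS]mxE.
  by rewrite -mulmx_colsub Wf mulmx1.
have b0f j : b0 ord0 (f j) = 0.
  by rewrite [LHS]mxE [X in _ + X]mxE mulWf mxE subrr.
have CW x : C x <-> exists t : 'rV_r, x = b0 + t *m W.
  rewrite CM -WM; split=> [/submxP[t ht]|[t ->]].
    exists (t + colsub f b); rewrite mulmxDl -ht /b0.
    by rewrite [x - b + _]addrC addrA subrK addrC subrK.
  rewrite /b0 addrAC [b - _]addrC addrK addrC -mulNmx -mulmxDl.
  exact: submxMl.
(* Padding by zero vectors gives three directions whatever the dimension of [C]. *)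
pose w (i : nat) : pt := if insub i is Some j then row j W else 0.
have wE (j : 'I_r) : w j = row j W by rewrite /w valK.
have w0 i : (r <= i)%N -> w i = 0 by move=> ri; rewrite /w insubF // ltnNge ri.
have r3 : (r <= 3)%N by exact: rank_leq_col.
pose s (j : 'I_3) := j \in codom f.
have vertex (t : 'rV_r) : (forall j, bit (t ord0 j)) -> chart_vertex C s (b0 + t *m W).
  have coord (u : 'rV_r) j : (b0 + u *m W) ord0 (f j) = u ord0 j.
    by rewrite [LHS]mxE b0f add0r mulWf.
  move=> ht; split.
  - by apply/CW; exists t.
  - by move=> j /codomP[i ->]; rewrite coord.
  - move=> y /CW[u ->] hu; congr (_ + _ *m W); apply/rowP => j.
    by have := hu (f j) (codom_f f j); rewrite !coord.
have b0E : b0 = b0 + 0 *m W by rewrite mul0mx addr0.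
have v0 : chart_vertex C s b0.
  by rewrite b0E; apply: vertex => j; left; rewrite mxE.
exists s, b0, (fun i => b0 + w i); split=> //; last first.
  move=> i; rewrite /w; case: insubP => [j _ _|_]; last by rewrite addr0.
  rewrite rowE; apply: vertex => l; rewrite mxE eqxx /=.
  by case: (l == j); [right|left].
move=> x; rewrite CW /affine_span.
have sumE (t : 'I_3 -> R) : \sum_(i < 3) t i *: (b0 + w i - b0) =
    (\row_(j < r) t (widen_ord r3 j)) *m W.
  rewrite mulmx_sum_row.
  transitivity (\sum_(i < 3 | (i < r)%N) t i *: w i).
    rewrite [RHS]big_mkcond; apply: eq_bigr => i _; rewrite addrAC subrr add0r.
    by case: ltnP => // /w0->; rewrite scaler0.
  rewrite (big_ord_narrow r3); apply: eq_bigr => j _.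
  by rewrite mxE -wE.
split=> [[t ->]|[t ->]]; last by exists (\row_j t (widen_ord r3 j)); rewrite sumE.
exists (fun i => if insub (val i) is Some j then t ord0 j else 0).
rewrite sumE; congr (_ + _ *m W); apply/rowP => j; rewrite mxE /=.
by rewrite valK.
Qed.

End Frame.

Section IsolatedCoordinates.
Variable R : realType.
Notation pt := 'rV[R]_3.
Variable V : (nat -> R) -> R -> R -> R -> Prop.
(** [V] is a family of sets definable uniformly in the parameters [e]; it is instantiated by
    [critical], where [e] holds the coefficients. *)
Hypothesis dV : forall (g : nat -> (nat -> R) -> R) a b c,
  (forall i, PF (g i)) -> PF a -> PF b -> PF c ->
  SA (fun e => V (fun i => g i e) (a e) (b e) (c e)).
Implicit Type e : nat -> R.

(** The [s] are switches: 1 freezes a coordinate at [c], 0 makes its equation vacuous. Quantifying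
    over bits thus treats all slices in one formula. *)
Definition slice e s1 s2 s3 c1 c2 c3 x y z :=
  V e x y z /\ (s1 * (x - c1) = 0 /\ s2 * (y - c2) = 0 /\ s3 * (z - c3) = 0).

Definition isolated_by (S : R -> R -> R -> Prop) x y z d :=
  forall x', forall y', forall z', S x' y' z' ->
    (x' - x) ^+ 2 + (y' - y) ^+ 2 + (z' - z) ^+ 2 < d -> x' = x /\ y' = y /\ z' = z.

Definition isolated_coordinate e u :=
  exists s1, bit s1 /\ exists s2, bit s2 /\ exists s3, bit s3 /\
  exists c1, bit c1 /\ exists c2, bit c2 /\ exists c3, bit c3 /\
  exists x, exists y, exists z, slice e s1 s2 s3 c1 c2 c3 x y z /\
  (exists d, 0 < d /\ isolated_by (slice e s1 s2 s3 c1 c2 c3) x y z d) /\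
  (u = x \/ u = y \/ u = z).

Ltac sa_V := sa; (apply: dV; [move=> ?|..]); sa.

Lemma SA_isolated_coordinate :
  SA (fun e => isolated_coordinate (fun i => e i.+1) (e 0%N)).
Proof.
rewrite /isolated_coordinate /isolated_by /slice /bit; sa_V.
Qed.

Lemma def3_slice e s1 s2 s3 c1 c2 c3 : def3 (slice e s1 s2 s3 c1 c2 c3).
Proof. by rewrite /def3 /slice; sa; apply: dV => *; sa. Qed.

(** An isolated point is determined by its slice, a rational below its squared isolation radius, and
    a rational point close enough to it. *)
Lemma coded_isolated_coordinate e : countably_coded (isolated_coordinate e).
Proof.
have bitP (s : R) : bit s -> exists b : bool, s = b%:R.
  by case=> ->; [exists false|exists true].
(* Two numbers near the same [q] satisfy [(t' - t) ^+ 2 < 4 * r / 12], so three coordinates add up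
   to less than [r]. *)
pose near (x : R) (q r : rat) := 12 * (x - ratr q) ^+ 2 < ratr r.
pose code u (k : (bool * bool * bool) * (bool * bool * bool) * 'I_3 *
    (rat * rat * rat * rat)) := let: (s1, s2, s3, (c1, c2, c3), j, (q1, q2, q3, r)) := k in
  exists x y z, let S := slice e s1%:R s2%:R s3%:R c1%:R c2%:R c3%:R in
    [/\ S x y z, isolated_by S x y z (ratr r), u = nth x [:: x; y; z] j &
        [/\ near x q1 r, near y q2 r & near z q3 r]].
exists _, code; split.
  move=> u [s1 [/bitP[b1 ->] [s2 [/bitP[b2 ->] [s3 [/bitP[b3 ->]]]]]]].
  move=> [c1 [/bitP[d1 ->] [c2 [/bitP[d2 ->] [c3 [/bitP[d3 ->]]]]]]].
  move=> [x [y [z [Sxyz [[d [d0 iso]] uE]]]]].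
  have [r /andP[r0 rd]] := rat_between d0.
  have exq (t : R) : exists q : rat, near t q r.
    (* As [m <= 1], the square of [m] is at most [m], hence at most [r / 12]. *)
    pose m : R := Num.min 1 (ratr r / 12).
    have m0 : 0 < m by rewrite lt_min ltr01; lra.
    have m1 : m <= 1 by rewrite ge_min lexx.
    have mr : m <= ratr r / 12 by rewrite ge_min lexx orbT.
    have [q /andP[tq qt]] : exists q : rat, t - m < ratr q < t + m.
      by apply: rat_between; lra.
    by exists q; rewrite /near; nra.
  have [[q1 n1] [q2 n2] [q3 n3]] := And3 (exq x) (exq y) (exq z).
  have [j uj] : exists j : 'I_3, u = nth x [:: x; y; z] j.
    by case: uE => [|[]] ->; [exists 0|exists 1|exists 2%:R].
  exists (b1, b2, b3, (d1, d2, d3), j, (q1, q2, q3, r)), x, y, z; split=> //.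
  by move=> x' y' z' S' h; apply: iso => //; apply: lt_trans rd.
move=> u v [[[[[s1 s2] s3] [[c1 c2] c3]] j] [[[q1 q2] q3] r]] _ _ /=.
move=> [x [y [z [Sx iso -> [n1 n2 n3]]]]] [x' [y' [z' [Sx' _ -> [n1' n2' n3']]]]].
have close (t t' : R) q : near t q r -> near t' q r -> 3 * (t' - t) ^+ 2 < ratr r.
  by rewrite /near => h h'; have := sqr_ge0 (t - ratr q + (t' - ratr q)); nra.
have [||-> [-> ->]] // := iso x' y' z'.
have := close _ _ _ n1 n1'; have := close _ _ _ n2 n2'; have := close _ _ _ n3 n3'.
by lra.
Qed.

(** Otherwise [f] stays true on an interval around [u], against countability. Since [f] does not
    depend on [e], its finite list of atoms serves all parameters. *)
Lemma isolated_coordinate_atoms (f : fm R) e u :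
  (forall e', isolated_coordinate (fun i => e' i.+1) (e' 0%N) <-> sat e' f) ->
  isolated_coordinate e u -> has (is_atom_root e u) (atoms f).
Proof.
move=> hf De; apply: contrapT => /negP /fm_locally_constant[d d0 hd].
have [|v /andP[v1 v2]] := coded_no_interval (coded_isolated_coordinate e) (_ : u - d < u + d).
  by lra.
case; apply/(hf (scons v e)); rewrite hd; first exact/(hf (scons u e)).
by rewrite ltr_norml; apply/andP; split; lra.
Qed.

Definition mk3 (x y z : R) : pt := \row_(i < 3) nth x [:: x; y; z] i.

Lemma mk3K (v : pt) : mk3 (v ord0 0) (v ord0 1) (v ord0 2%:R) = v.
Proof.
apply/rowP => -[[|[|[|//]]] h]; rewrite mxE /=; congr (v _ _); exact: val_inj.
Qed.

Lemma chart_vertex_coordinate (p : {mpoly R[3]}) e (C : pt -> Prop) s v (j : 'I_3) :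
  (forall w : pt, crit_set p w <-> V e (w ord0 0) (w ord0 1) (w ord0 2%:R)) ->
  V_aff p C -> chart_vertex C s v -> isolated_coordinate e (v ord0 j).
Proof.
move=> hV aC [Cv sv vuniq].
(* The chart coordinates of [v] are frozen at their values, which are bits; the others get the dummy
   value 0. *)
pose S := slice e (s 0)%:R (s 1)%:R (s 2%:R)%:R
  (if s 0 then v ord0 0 else 0) (if s 1 then v ord0 1 else 0)
  (if s 2%:R then v ord0 2%:R else 0).
have bitb (b : bool) : bit (b%:R : R) by case: b; [right|left].
have bitc i : bit (if s i then v ord0 i else 0) by case: ifP => [/sv|]//; left.
have [_ CV _] := aC.
have Sv : S (v ord0 0) (v ord0 1) (v ord0 2%:R).
  split; first exact/hV/CV.
  by do !split; case: (s _); rewrite ?subrr ?mulr0 ?mul0r.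
exists (s 0)%:R; split=> //; exists (s 1)%:R; split=> //.
exists (s 2%:R)%:R; split=> //.
exists (if s 0 then v ord0 0 else 0); split=> //.
exists (if s 1 then v ord0 1 else 0); split=> //.
exists (if s 2%:R then v ord0 2%:R else 0); split=> //.
exists (v ord0 0), (v ord0 1), (v ord0 2%:R); split=> //; split; last first.
  case: j => [[|[|[|//]]] h]; [left|right; left|right; right]; congr (v _ _);
  exact: val_inj.
rewrite -/S; apply: contrapT => niso.
have [||d d0 [f1 [f2 [f3 hf]]]] :=
    @curve_selection R S (v ord0 0) (v ord0 1) (v ord0 2%:R).
- exact: def3_slice.
- move=> d d0; apply: contrapT => h; apply: niso; exists d; split=> // x y z Sxyz hd.
  have [e0|n0] := eqVneq (sqd (v ord0 0) (v ord0 1) (v ord0 2%:R) x y z) 0.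
    move: e0; rewrite /sqd; set a := (x - _); set b := (y - _); set c := (z - _) => e0.
    have := sqr_ge0 a; have := sqr_ge0 b; have := sqr_ge0 c => c0 b0 a0.
    have /eqP : a ^+ 2 = 0 by lra.
    have /eqP : b ^+ 2 = 0 by lra.
    have /eqP : c ^+ 2 = 0 by lra.
    by rewrite !sqrf_eq0 !subr_eq0 => /eqP-> /eqP-> /eqP->.
  case: h; exists x, y, z; split=> //; apply/andP; split=> //.
  rewrite lt_neqAle eq_sym n0 /= /sqd; have := sqr_ge0 (x - v ord0 0).
  have := sqr_ge0 (y - v ord0 1); have := sqr_ge0 (z - v ord0 2%:R); lra.
(* The selected arc, completed by its limit [v] at parameter 0. *)
pose g t := if 0 < t then mk3 (f1 t) (f2 t) (f3 t) else v.
pose I t := 0 <= t < d.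
pose D w := exists t, I t /\ w = g t.
have DV w : D w -> crit_set p w.
  move=> [t [/andP[t0 td] ->]]; rewrite /g; case: ltP => t0'; last exact: CV.
  have [[Vt _] _ _] := hf t (introT andP (conj t0' td)).
  by apply/hV; rewrite !mxE.
have Dv : D v by exists 0; rewrite /I /g lexx d0 ltxx.
have cD : connected3 D.
  apply: connected_image => [r t s' /andP[r0 _] /andP[_ td] /andP[rs st]|].
    by rewrite /I (le_trans r0) //= (le_lt_trans st).
  move=> t /andP[t0 td] n n0; move: t0; rewrite le_eqVlt => /orP[/eqP<-|t0].
    (* The parameter is a squared distance, so it must stay below the square of the tolerance. *)
    exists (Num.min 1 n * Num.min 1 n).
      by rewrite mulr_gt0 ?lt_min ?ltr01.
    move=> r /andP[r0 rd]; rewrite subr0 ger0_norm // => rn.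
    rewrite {1}/g ltxx /g; case: (ltP 0 r) => r0'; last exact: dist3_refl.
    have [_ q _] := hf r (introT andP (conj r0' rd)).
    have m0 : 0 < Num.min 1 n by rewrite lt_min ltr01.
    have mn : Num.min 1 n <= n by rewrite ge_min lexx orbT.
    have bound (x y : R) : (y - x) ^+ 2 <= r -> `|x - y| < n.
      move=> h; apply: lt_le_trans mn; rewrite ltr_norml.
      by apply/andP; split; nra.
    move: q; rewrite /sqd; have := sqr_ge0 (f1 r - v ord0 0).
    have := sqr_ge0 (f2 r - v ord0 1); have := sqr_ge0 (f3 r - v ord0 2%:R).
    by move=> ? ? ? ?; apply/dist3_lt; split; rewrite !mxE /=; apply: bound; lra.
  have [_ _ [c1 c2 c3]] := hf t (introT andP (conj t0 td)).
  have [d1 d10 h1] := c1 n n0; have [d2 d20 h2] := c2 n n0.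
  have [d3 d30 h3] := c3 n n0.
  (* The bound [t] keeps the nearby parameters positive. *)
  exists (Num.min (Num.min d1 d2) (Num.min d3 t)); first by rewrite !lt_min d10 d20 d30.
  move=> r _; rewrite !lt_min => /andP[/andP[r1 r2] /andP[r3 rt]].
  have r0 : 0 < r by move: rt; rewrite ltr_norml => /andP[]; lra.
  rewrite /g t0 r0; apply/dist3_lt; split; rewrite !mxE /= distrC.
  - exact: h1.
  - exact: h2.
  - exact: h3.
(* Any positive parameter would do: the arc point lies in [C] with the chart coordinates of [v],
   hence equals [v], although its squared distance to [v] is positive. *)
have d2 : 0 < d / 2 < d by lra.
have [St qt _] := hf _ d2; have /andP[d20 d2d] := d2.
have Dt : D (mk3 (f1 (d / 2)) (f2 (d / 2)) (f3 (d / 2))).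
  by exists (d / 2); rewrite /I /g d20 ltW.
have Ct := V_aff_absorb aC cD DV (ex_intro _ v (conj Cv Dv)) Dt.
have vE : mk3 (f1 (d / 2)) (f2 (d / 2)) (f3 (d / 2)) = v.
  apply: vuniq => //; have [_ [e1 [e2 e3]]] := St.
  have bitE (b : bool) (x y : R) : b -> b%:R * (x - if b then y else 0) = 0 -> x = y.
    by move=> ->; rewrite mul1r => /subr0_eq.
  move=> i si; rewrite mxE; case: i si => [[|[|[|//]]] h] /= si.
  - rewrite (_ : Ordinal h = 0) in si *; last exact: val_inj.
    exact: bitE si e1.
  - rewrite (_ : Ordinal h = 1) in si *; last exact: val_inj.
    exact: bitE si e2.
  - rewrite (_ : Ordinal h = 2%:R) in si *; last exact: val_inj.
    exact: bitE si e3.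
move: qt; rewrite -vE !mxE /= /sqd !subrr expr0n /=; lra.
Qed.

End IsolatedCoordinates.

(** * The critical set in terms of the coefficients *)

Section CriticalSet.
Variable R : realType.
Notation pt := 'rV[R]_3.
Implicit Type e : nat -> R.

Definition ncoef := size deg3_monoms.

(** Written linearly in the coefficients [e], so that they become variables of the formulas and
    quantifiers are eliminated once for all [p]. *)
Definition grad e (j : 'I_3) (v : pt) : R :=
  \sum_(i < ncoef) e i * peval ('X_[nth 0%MM deg3_monoms i]^`M(j)) v.

Definition critical e x y z := grad e 0 (mk3 x y z) = 0 /\
  grad e 1 (mk3 x y z) = 0 /\ grad e 2%:R (mk3 x y z) = 0.

Lemma PF_peval (q : {mpoly R[3]}) a b c : PF a -> PF b -> PF c ->
  PF (fun e => peval q (mk3 (a e) (b e) (c e))).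
Proof.
move=> pa pb pc.
have [t ht] : PF (fun e => \sum_(m <- msupp q) q@_m * (a e ^+ m 0 * b e ^+ m 1 * c e ^+ m 2%:R)).
  by apply: PF_sum => m; sa.
exists t => e; rewrite -ht /peval mevalE; apply: eq_bigr => m _; congr (_ * _).
rewrite !big_ord_recl big_ord0 mulr1 !mxE /= mulrA.
by congr (_ ^+ m _ * _ ^+ m _ * _ ^+ m _); apply: val_inj.
Qed.

Lemma SA_critical (g : nat -> (nat -> R) -> R) a b c :
  (forall i, PF (g i)) -> PF a -> PF b -> PF c ->
  SA (fun e => critical (fun i => g i e) (a e) (b e) (c e)).
Proof.
move=> pg pa pb pc; rewrite /critical /grad.
have pj j : PF (fun e => \sum_(i < ncoef) g i e *
    peval ('X_[nth 0%MM deg3_monoms i]^`M(j)) (mk3 (a e) (b e) (c e))).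
  by apply: PF_sum => i; apply: PF_mul => //; apply: PF_peval.
by apply: SA_and; [|apply: SA_and]; apply: SA_eq => //; apply: PF_cst.
Qed.

Lemma critical_ext e e' x y z : (forall i, (i < ncoef)%N -> e i = e' i) ->
  critical e x y z <-> critical e' x y z.
Proof.
move=> ee; have gE j v : grad e j v = grad e' j v.
  by apply: eq_bigr => i _; rewrite ee.
by rewrite /critical !gE.
Qed.

Lemma sum_deg3_monoms (F : 'X_{1..3} -> R) :
  \sum_(m : 'X_{1..3 < 4}) F m = \sum_(i < ncoef) F (nth 0%MM deg3_monoms i).
Proof.
rewrite -(big_mkord predT (fun i => F (nth 0%MM deg3_monoms i))).
by rewrite -(big_nth 0%MM predT) big_map big_enum.
Qed.

Lemma grad_input (p : {mpoly R[3]}) j v : (msize p <= 4)%N ->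
  grad (input_regs p) j v = peval (p^`M(j)) v.
Proof.
move=> p4; rewrite /grad [in RHS](mpolywE p4) /peval.
rewrite (raddf_sum (mderiv j)) (raddf_sum (meval _)).
rewrite [RHS](sum_deg3_monoms (fun m => meval _ (mderiv j (p@_m *: 'X_[m])))).
by apply: eq_bigr => i _; rewrite mderivZ mevalZ /input_regs ltn_ord.
Qed.

Lemma crit_set_critical (p : {mpoly R[3]}) (e : nat -> R) (v : pt) :
  (msize p <= 4)%N -> (forall i, (i < ncoef)%N -> e i = input_regs p i) ->
  crit_set p v <-> critical e (v ord0 0) (v ord0 1) (v ord0 2%:R).
Proof.
move=> p4 ee; apply: iff_trans (iff_sym (critical_ext _ _ _ ee)).
rewrite /critical mk3K !grad_input //; split=> [h|[h0 [h1 h2]]]; first by do !split.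
case=> [[|[|[|//]]] h].
- by rewrite (_ : Ordinal h = 0) //; exact: val_inj.
- by rewrite (_ : Ordinal h = 1) //; exact: val_inj.
- by rewrite (_ : Ordinal h = 2%:R) //; exact: val_inj.
Qed.

End CriticalSet.

(** * Compilation to the machine *)

Section Machine.
Variable R : realType.
Notation pt := 'rV[R]_3.
Implicit Types (s e : nat -> R) (h : nat -> reg) (d : reg) (o : seq (out_item R)).

(** Register discipline of the compiler: [d] is the first free register, results are stored from [d]
    on, and those below [d] survive. *)
Definition agree d s s' := forall i, (i < d)%N -> s' i = s i.

Lemma agree_trans d d' s1 s2 s3 : (d <= d')%N ->
  agree d s1 s2 -> agree d' s2 s3 -> agree d s1 s3.
Proof. by move=> dd' h1 h2 i id; rewrite h2 ?h1 // (leq_trans id). Qed.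

Lemma agree_upd d d' s v : (d <= d')%N -> agree d s (upd s d' v).
Proof. by move=> dd' i id; rewrite /upd ltn_eqF // (leq_trans id). Qed.

Lemma upd_same s d v : upd s d v d = v. Proof. by rewrite /upd eqxx. Qed.

Lemma agree_env d s s' h : (forall i, h i < d)%N -> agree d s s' ->
  (fun i => s' (h i)) = fun i => s (h i).
Proof. by move=> hd a; apply: funext => i; apply: a. Qed.

Fixpoint tm_prog h (t : tm R) d : cmd R :=
  match t with
  (* A register is copied by adding it to 0. *)
  | TVar n => CSeq (CConst d 0) (CAdd R d d (h n))
  | TCst c => CConst d c
  | TAdd a b => CSeq (tm_prog h a d) (CSeq (tm_prog h b d.+1) (CAdd R d d d.+1))
  | TMul a b => CSeq (tm_prog h a d) (CSeq (tm_prog h b d.+1) (CMul R d d d.+1))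
  end.

Lemma exec_tm h t d s o : (forall i, h i < d)%N -> exists s',
  [/\ exec (tm_prog h t d) (s, o) (s', o), agree d s s' &
      s' d = teval (fun i => s (h i)) t].
Proof.
elim: t d s => /= [n|c|a IHa b IHb|a IHa b IHb] d s hd.
- exists (upd (upd s d 0) d (upd s d 0 d + upd s d 0 (h n))); split.
  + by apply: ESeq; [exact: EConst|exact: EAdd].
  + by apply: (@agree_trans _ d _ (upd s d 0)) => //; exact: agree_upd.
  + by rewrite !upd_same add0r; apply: agree_upd (hd n).
- by exists (upd s d c); split; [exact: EConst|exact: agree_upd|rewrite upd_same].
- have [s1 [x1 a1 v1]] := IHa d s hd.
  have hd' i : (h i < d.+1)%N by rewrite ltnS ltnW.
  have [s2 [x2 a2 v2]] := IHb d.+1 s1 hd'.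
  exists (upd s2 d (s2 d + s2 d.+1)); split.
  + by apply: ESeq x1 _; apply: ESeq x2 _; exact: EAdd.
  + apply: (@agree_trans _ d _ s2) => //; last exact: agree_upd.
    by apply: (@agree_trans _ d.+1 _ s1).
  + by rewrite upd_same a2 // v1 v2 (agree_env hd a1).
- have [s1 [x1 a1 v1]] := IHa d s hd.
  have hd' i : (h i < d.+1)%N by rewrite ltnS ltnW.
  have [s2 [x2 a2 v2]] := IHb d.+1 s1 hd'.
  exists (upd s2 d (s2 d * s2 d.+1)); split.
  + by apply: ESeq x1 _; apply: ESeq x2 _; exact: EMul.
  + apply: (@agree_trans _ d _ s2) => //; last exact: agree_upd.
    by apply: (@agree_trans _ d.+1 _ s1).
  + by rewrite upd_same a2 // v1 v2 (agree_env hd a1).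
Qed.

(** Truth values are the numbers 0 and 1: negation is [1 - x] and conjunction is the product. *)
Fixpoint fm_prog h (f : fm R) d : cmd R :=
  match f with
  | FPos t => CSeq (tm_prog h t d) (CIf d (CConst d 1) (CConst d 0))
  | FNot f => CSeq (fm_prog h f d) (CSeq (CConst d.+1 1) (CSub R d d.+1 d))
  | FAnd f g => CSeq (fm_prog h f d) (CSeq (fm_prog h g d.+1) (CMul R d d d.+1))
  end.

Lemma exec_fm h f d s o : (forall i, h i < d)%N -> exists s',
  [/\ exec (fm_prog h f d) (s, o) (s', o), agree d s s' &
      s' d = (sat (fun i => s (h i)) f)%:R].
Proof.
elim: f d s => /= [t|f IHf|f IHf g IHg] d s hd.
- have [s1 [x1 a1 v1]] := exec_tm t s o hd; rewrite -v1.
  case: ltP => hs; [exists (upd s1 d 1)|exists (upd s1 d 0)]; (split; last 1 first).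
  + by rewrite upd_same.
  + by apply: ESeq x1 _; apply: EIfT => //; exact: EConst.
  + by apply: (@agree_trans _ d _ s1) => //; exact: agree_upd.
  + by rewrite upd_same.
  + by apply: ESeq x1 _; apply: EIfF; [apply/negP; rewrite -leNgt|exact: EConst].
  + by apply: (@agree_trans _ d _ s1) => //; exact: agree_upd.
- have [s1 [x1 a1 v1]] := IHf d s hd; pose s2 := upd s1 d.+1 1.
  exists (upd s2 d (s2 d.+1 - s2 d)); split.
  + by apply: ESeq x1 _; apply: ESeq; [exact: EConst|exact: ESub].
  + apply: (@agree_trans _ d _ s2) => //; last exact: agree_upd.
    by apply: (@agree_trans _ d _ s1) => //; exact: agree_upd.
  + rewrite upd_same /s2 upd_same /upd ltn_eqF // v1.
    by case: (sat _ _); rewrite ?subrr ?subr0.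
- have [s1 [x1 a1 v1]] := IHf d s hd.
  have hd' i : (h i < d.+1)%N by rewrite ltnS ltnW.
  have [s2 [x2 a2 v2]] := IHg d.+1 s1 hd'.
  exists (upd s2 d (s2 d * s2 d.+1)); split.
  + by apply: ESeq x1 _; apply: ESeq x2 _; exact: EMul.
  + apply: (@agree_trans _ d _ s2) => //; last exact: agree_upd.
    by apply: (@agree_trans _ d.+1 _ s1).
  + by rewrite upd_same a2 // v1 v2 (agree_env hd a1) -natrM mulnb.
Qed.

(** * Extracting the roots of polynomials with computed coefficients *)

Fixpoint tdeg (t : tm R) : nat :=
  match t with
  | TVar _ => 1
  | TCst _ => 0
  | TAdd a b => maxn (tdeg a) (tdeg b)
  | TMul a b => tdeg a + tdeg b
  end.

(** The coefficients of [tpoly] are kept as terms in the parameters, so that [tm_prog] can compute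
    them at run time. *)
Fixpoint tcoef (t : tm R) (k : nat) : tm R :=
  match t with
  | TVar 0 => TCst (k == 1)%:R
  | TVar j.+1 => if k is 0 then TVar R j else TCst 0
  | TCst c => if k is 0 then TCst c else TCst 0
  | TAdd a b => TAdd (tcoef a k) (tcoef b k)
  | TMul a b => foldr (fun i => TAdd (TMul (tcoef a i) (tcoef b (k - i)))) (TCst 0)
                      (iota 0 k.+1)
  end.

Lemma teval_tcoef e t k : teval e (tcoef t k) = (tpoly e t)`_k.
Proof.
elim: t k => [[|j]|c|a IHa b IHb|a IHa b IHb] k.
- by rewrite /= coefX.
- by rewrite /= coefC; case: k.
- by rewrite /= coefC; case: k.
- by rewrite /= coefD IHa IHb.
rewrite [tpoly _ _]/= coefM.
rewrite -(big_mkord predT (fun i => (tpoly e a)`_i * (tpoly e b)`_(k - i))).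
have -> : tcoef (TMul a b) k = foldr (fun i => TAdd (TMul (tcoef a i)
  (tcoef b (k - i)))) (TCst 0) (iota 0 k.+1) by [].
rewrite /index_iota subn0.
elim: (iota 0 k.+1) => [|i l IHl]; first by rewrite big_nil.
by rewrite big_cons -IHl /= IHa IHb.
Qed.

Lemma size_tpoly e t : (size (tpoly e t) <= (tdeg t).+1)%N.
Proof.
elim: t => [[|j]|c|a IHa b IHb|a IHa b IHb] /=.
- by rewrite size_polyX.
- by rewrite (leq_trans (size_polyC_leq1 _)).
- exact: size_polyC_leq1.
- by rewrite (leq_trans (size_polyD _ _)) // -maxnSS geq_max !leq_max IHa IHb orbT.
- rewrite (leq_trans (size_polyMleq _ _)) //.
  by rewrite -subn1 leq_subLR add1n -addnS -addSn leq_add.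
Qed.

Fixpoint tms_prog h (ts : seq (tm R)) d : cmd R :=
  if ts is t :: ts' then CSeq (tm_prog h t d) (tms_prog h ts' d.+1) else CSkip R.

Lemma exec_tms h ts d s o : (forall i, h i < d)%N -> exists s',
  [/\ exec (tms_prog h ts d) (s, o) (s', o), agree d s s' &
      forall i, (i < size ts)%N ->
        s' (d + i)%N = teval (fun i => s (h i)) (nth (TCst 0) ts i)].
Proof.
elim: ts d s => /= [|t ts IH] d s hd.
  by exists s; split=> //; exact: ESkip.
have [s1 [x1 a1 v1]] := exec_tm t s o hd.
have hd' i : (h i < d.+1)%N by rewrite ltnS ltnW.
have [s2 [x2 a2 v2]] := IH d.+1 s1 hd'.
exists s2; split; first exact: ESeq x1 x2.
  by apply: (@agree_trans _ d.+1 _ s1).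
case=> [_|i /=]; first by rewrite addn0 a2.
by rewrite ltnS addnS -addSn => /v2->; rewrite (agree_env hd a1).
Qed.

Definition roots_lt (q : {poly R}) x := [seq y <- polyrcf.rootsR q | y < x].

Lemma roots_ltP (q : {poly R}) x : q != 0 -> roots_below q x (roots_lt q x).
Proof.
move=> q0; split=> [|y].
  by apply: sorted_filter; [exact: lt_trans|exact: polyrcf.sorted_roots].
rewrite mem_filter -(polyrcf.roots_on_rootsR q0) in_itv /= andbC.
by split=> [/andP|[-> ->]].
Qed.

Lemma roots_below_uniq (q : {poly R}) x l l' : roots_below q x l -> roots_below q x l' -> l = l'.
Proof.
move=> [sl hl] [sl' hl']; apply: (irr_sorted_eq lt_trans ltxx sl sl') => y.
by apply/idP/idP => [/hl/hl'|/hl'/hl].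
Qed.

Lemma size_roots_lt (q : {poly R}) x : q != 0 -> (size (roots_lt q x) < size q)%N.
Proof.
move=> q0; apply: max_poly_roots => //.
  apply/allP => y; rewrite mem_filter -(polyrcf.roots_on_rootsR q0).
  by rewrite in_itv /= => /andP[].
by apply: filter_uniq; exact: polyrcf.uniq_roots.
Qed.

Lemma size_roots_lt_inj (q : {poly R}) x y : q != 0 -> root q x -> root q y ->
  size (roots_lt q x) = size (roots_lt q y) -> x = y.
Proof.
move=> q0; suff aux u v : root q u -> u < v ->
    (size (roots_lt q u) < size (roots_lt q v))%N.
  move=> rx ry; case: (ltgtP x y) => // h.
    by have := aux _ _ rx h => + e; rewrite e ltnn.
  by have := aux _ _ ry h => + e; rewrite e ltnn.
move=> ru uv.
have urv : uniq (u :: roots_lt q u).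
  by rewrite /= mem_filter ltxx filter_uniq // polyrcf.uniq_roots.
apply: (uniq_leq_size urv) => w; rewrite inE => /orP[/eqP->|].
  by apply/(proj2 (roots_ltP v q0)).
move=> /(proj2 (roots_ltP u q0))[rw wu].
by apply/(proj2 (roots_ltP v q0)); split=> //; exact: lt_trans uv.
Qed.

(** Only genuine roots of rank [k] are promised. A job without such a root may store any value,
    since every hull is tested before it is output. *)
Lemma exec_root s o d cs k : exists v, exec (CRoot R d cs k) (s, o) (upd s d v, o) /\
  forall x, poly_of s cs != 0 -> root (poly_of s cs) x ->
    size (roots_lt (poly_of s cs) x) = k -> v = x.
Proof.
set q := poly_of s cs.
case: (pselect (q != 0 /\ exists x l, [/\ root q x, roots_below q x l & size l = k])).
  move=> [q0 [x [l [rx lx lk]]]]; exists x; split; first exact: ERoot q0 rx lx lk.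
  move=> y _ ry yk; apply: (size_roots_lt_inj q0) => //.
  by rewrite yk -lk (roots_below_uniq lx (roots_ltP x q0)).
move=> h; exists 0; split; first exact: ERootNone.
move=> x q0 rx xk; case: h; split=> //.
by exists x, (roots_lt q x); split=> //; exact: roots_ltP.
Qed.

Definition root_prog h (j : tm R * nat) d : cmd R :=
  CSeq (tms_prog h (map (tcoef j.1) (iota 0 (tdeg j.1).+1)) d)
       (CRoot R d (iota d (tdeg j.1).+1) j.2).

Definition is_job_root e u (j : tm R * nat) :=
  is_atom_root e u j.1 && (size (roots_lt (tpoly e j.1) u) == j.2).

Lemma exec_root_prog h j d s o : (forall i, h i < d)%N -> exists s',
  [/\ exec (root_prog h j d) (s, o) (s', o), agree d s s' &
      forall u, is_job_root (fun i => s (h i)) u j -> s' d = u].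
Proof.
move=> hd; pose e i := s (h i).
pose ts := map (tcoef j.1) (iota 0 (tdeg j.1).+1).
have [s1 [x1 a1 v1]] := exec_tms ts s o hd.
pose cs := iota d (tdeg j.1).+1; have [v [x2 v2]] := exec_root s1 o d cs j.2.
have pE : poly_of s1 cs = tpoly e j.1.
  apply/polyP => i; rewrite coef_poly size_iota; case: ltnP => ij.
    rewrite nth_iota // v1 ?size_map ?size_iota // (nth_map 0%N) ?size_iota //.
    by rewrite nth_iota // teval_tcoef.
  by rewrite nth_default // (leq_trans (size_tpoly _ _)).
exists (upd s1 d v); split; first exact: ESeq x1 x2.
  by apply: (@agree_trans _ d _ s1) => //; exact: agree_upd.
move=> u /andP[/andP[q0 ru] /eqP k]; rewrite upd_same; apply: v2; rewrite pE //.
Qed.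

Fixpoint pool_prog h (J : seq (tm R * nat)) d : cmd R :=
  if J is j :: J' then CSeq (root_prog h j d) (pool_prog h J' d.+1) else CSkip R.

Lemma exec_pool h J d s o : (forall i, h i < d)%N -> exists s',
  [/\ exec (pool_prog h J d) (s, o) (s', o), agree d s s' &
      forall u, has (is_job_root (fun i => s (h i)) u) J ->
        exists2 r, r \in iota d (size J) & s' r = u].
Proof.
elim: J d s => /= [|j J IH] d s hd; first by exists s; split=> //; exact: ESkip.
have [s1 [x1 a1 v1]] := exec_root_prog j s o hd.
have hd' i : (h i < d.+1)%N by rewrite ltnS ltnW.
have [s2 [x2 a2 v2]] := IH d.+1 s1 hd'.
exists s2; split; first exact: ESeq x1 x2.
  by apply: (@agree_trans _ d.+1 _ s1).
move=> u /orP[/v1 du|hu]; first by exists d; rewrite ?mem_head // a2.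
have [|r rd ru] := v2 u; first by rewrite (agree_env hd a1).
by exists r => //; rewrite inE rd orbT.
Qed.

(** The ranks 0 to [tdeg t] suffice: a nonzero polynomial has no more roots than its degree, which
    [tdeg t] bounds. *)
Definition jobs (ts : seq (tm R)) : seq (tm R * nat) :=
  flatten [seq [seq (t, k) | k <- iota 0 (tdeg t).+1] | t <- ts].

Lemma has_jobs e u ts : has (is_atom_root e u) ts -> has (is_job_root e u) (jobs ts).
Proof.
elim: ts => // t ts IH.
have -> : jobs (t :: ts) = [seq (t, k) | k <- iota 0 (tdeg t).+1] ++ jobs ts by [].
rewrite has_cat => /orP[ht|/IH->]; last by rewrite orbT.
apply/orP; left; pose k := size (roots_lt (tpoly e t) u).
have q0 : tpoly e t != 0 by case/andP: ht.
have kt : (k < (tdeg t).+1)%N.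
  by apply: leq_trans (size_roots_lt u q0) (size_tpoly e t).
rewrite has_map; apply/hasP; exists k; first by rewrite mem_iota.
by rewrite /is_job_root /= ht eqxx.
Qed.

Fixpoint tuples (k : nat) (L : seq reg) : seq (seq reg) :=
  if k is k'.+1 then [seq x :: w | x <- L, w <- tuples k' L] else [:: [::]].

Lemma mem_tuples k L w : (w \in tuples k L) = (size w == k) && all (mem L) w.
Proof.
elim: k w => [|k IH] w /=; first by rewrite inE; case: w.
apply/allpairsP/idP => [[[x w'] /= [xL + ->]]|].
  by rewrite IH /= eqSS => /andP[-> ->]; rewrite xL.
case: w => [//|x w] /=; rewrite eqSS => /andP[kw /andP[xL wL]].
by exists (x, w); rewrite IH kw wL.
Qed.

Fixpoint sub_prog (l : seq (reg * reg)) d : cmd R :=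
  if l is (a, b) :: l' then CSeq (CSub R d a b) (sub_prog l' d.+1) else CSkip R.

Lemma exec_sub (l : seq (reg * reg)) d s o :
  all (fun ab => (ab.1 < d) && (ab.2 < d))%N l -> exists s',
  [/\ exec (sub_prog l d) (s, o) (s', o), agree d s s' &
      forall i, (i < size l)%N ->
        s' (d + i)%N = s (nth (0, 0)%N l i).1 - s (nth (0, 0)%N l i).2].
Proof.
elim: l d s => /= [|[a b] l IH] d s; first by exists s; split=> //; exact: ESkip.
move=> /andP[/= /andP[ad bd] ld].
have [|s2 [x2 a2 v2]] := IH d.+1 (upd s d (s a - s b)).
  apply: sub_all ld => -[a' b'] /= /andP[h1 h2].
  by rewrite !ltnS (ltnW h1) ltnW.
exists s2; split; first by apply: ESeq x2; exact: ESub.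
  by apply: (@agree_trans _ d.+1 _ (upd s d (s a - s b))) => //; exact: agree_upd.
case=> [_|i /= il]; first by rewrite addn0 a2 // upd_same.
have /(all_nthP (0, 0)%N)/(_ i il)/andP[h1 h2] := ld.
by rewrite addnS -addSn v2 //; rewrite /upd !ltn_eqF.
Qed.

(** * Testing and emitting the hulls of quadruples of points *)

Definition point s (w : seq reg) (k : nat) : pt :=
  vec_of s (nth 0%N w (3 * k), nth 0%N w (3 * k).+1, nth 0%N w (3 * k).+2).

Definition hull s w : out_item R :=
  (point s w 0, [seq point s w k - point s w 0 | k <- [:: 1; 2; 3]%N]).

(** Matches the variables of [hull_critical]: twelve coordinates read from the registers in [w],
    then the coefficients, shifted by 12. *)
Definition with_points h (w : seq reg) : nat -> reg :=
  fun i => if (i < 12)%N then nth 0%N w i else h (i - 12)%N.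

Definition emit_prog h (f : fm R) (d : reg) (w : seq reg) : cmd R :=
  CSeq (fm_prog (with_points h w) f d)
    (CIf d
      (* The coordinates of the last three points minus those of the first go to [d], ..., [d + 8],
         overwriting the truth value already tested. *)
      (CSeq (sub_prog [seq (nth 0%N w i, nth 0%N w (i %% 3)) | i <- iota 3 9] d)
        (CEmit R (nth 0%N w 0, nth 0%N w 1, nth 0%N w 2)
           [:: (d, d.+1, d.+2); (d + 3, d + 4, d + 5); (d + 6, d + 7, d + 8)]%N))
      (CSkip R)).

Lemma exec_emit h f d w s o : (forall i, h i < d)%N -> size w = 12%N ->
  all (fun r => r < d)%N w -> exists s', agree d s s' /\
  exec (emit_prog h f d w) (s, o)
    (s', o ++ nseq (sat (fun i => s (with_points h w i)) f) (hull s w)).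
Proof.
move=> hd w12 wd.
have wd' i : (i < 12)%N -> (nth 0%N w i < d)%N.
  by move=> i12; apply: (all_nthP 0%N wd); rewrite w12.
have hd' i : (with_points h w i < d)%N.
  by rewrite /with_points; case: (ltnP i 12) => hi; [exact: wd'|exact: hd].
have [s1 [x1 a1 v1]] := exec_fm f s o hd'.
case: (sat _ f) v1 => v1; last first.
  exists s1; split=> //; rewrite cats0; apply: ESeq x1 _.
  by apply: EIfF; [rewrite v1 ltxx|exact: ESkip].
have m3 i : (i %% 3 < 12)%N by apply: leq_trans (ltn_pmod _ _) _.
pose l := [seq (nth 0%N w i, nth 0%N w (i %% 3)) | i <- iota 3 9].
have [|s2 [x2 a2 v2]] := @exec_sub l d s1 o.
  rewrite all_map; apply/allP => i; rewrite mem_iota => /andP[_ i12] /=.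
  by apply/andP; split; apply: wd'.
exists s2; split; first exact: agree_trans a1 a2.
have -> : o ++ nseq true (hull s w) = rcons o (hull s w) by rewrite cats1.
apply: ESeq x1 _; apply: EIfT; first by rewrite v1 ltr01.
apply: ESeq x2 _.
have wE i : (i < 12)%N -> s2 (nth 0%N w i) = s (nth 0%N w i).
  by move=> /wd' id; rewrite a2 // a1.
have vE i : (i < 9)%N -> s2 (d + i)%N = s (nth 0%N w (3 + i)) - s (nth 0%N w (i %% 3)).
  move=> i9; rewrite v2 ?size_map // (nth_map 0%N) ?size_iota // nth_iota //=.
  by rewrite !a1 ?wd' // -[(3 + i)%N]/(1 * 3 + i)%N modnMDl.
rewrite [hull s w](_ : _ = (vec_of s2 (nth 0%N w 0, nth 0%N w 1, nth 0%N w 2),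
  map (vec_of s2) [:: (d, d.+1, d.+2); (d + 3, d + 4, d + 5); (d + 6, d + 7, d + 8)]%N)).
  exact: EEmit.
have e0 := vE 0%N erefl; have e1 := vE 1%N erefl; have e2 := vE 2%N erefl.
have e3 := vE 3%N erefl; have e4 := vE 4%N erefl; have e5 := vE 5%N erefl.
have e6 := vE 6%N erefl; have e7 := vE 7%N erefl; have e8 := vE 8%N erefl.
rewrite addn0 in e0; rewrite addn1 in e1; rewrite addn2 in e2.
rewrite /hull /point /=; congr (_, [:: _; _; _]); apply/rowP => -[[|[|[|//]]] ?];
  by rewrite !mxE /= ?wE.
Qed.

Definition emits_prog h f d ws : cmd R :=
  foldr (fun w => CSeq (emit_prog h f d w)) (CSkip R) ws.

Lemma exec_emits h f d ws s o : (forall i, h i < d)%N ->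
  all (fun w => (size w == 12) && all (fun r => r < d)%N w)%N ws -> exists s',
  exec (emits_prog h f d ws) (s, o)
    (s', o ++ [seq hull s w | w <- ws & sat (fun i => s (with_points h w i)) f]).
Proof.
move=> hd; elim: ws s o => /= [|w ws IH] s o.
  by exists s; rewrite cats0; exact: ESkip.
move=> /andP[/andP[/eqP w12 wd] wsd].
have [s1 [a1 x1]] := exec_emit f s o hd w12 wd.
have [s2 x2] := IH s1 (o ++ nseq (sat (fun i => s (with_points h w i)) f) (hull s w)) wsd.
exists s2; apply: ESeq x1 _.
(* Earlier tests and outputs change no register below [d], so the remaining tuples are read as in
   the initial state. *)
have eqs w' : (size w' == 12)%N && all (fun r => r < d)%N w' ->
    (hull s1 w' = hull s w') * ((fun i => s1 (with_points h w' i)) =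
      fun i => s (with_points h w' i)).
  move=> /andP[/eqP w'12 w'd].
  have w'd' i : (i < 12)%N -> s1 (nth 0%N w' i) = s (nth 0%N w' i).
    by move=> i12; apply: a1; apply: (all_nthP 0%N w'd); rewrite w'12.
  split.
    rewrite /hull /point /=; congr (_, [:: _ - _; _ - _; _ - _]);
    by apply/rowP => -[[|[|[|//]]] ?]; rewrite !mxE /= w'd'.
  apply: funext => i; rewrite /with_points; case: (ltnP i 12) => [/w'd'//|_].
  exact: a1.
suff E : [seq hull s1 w' | w' <- ws & sat (fun i => s1 (with_points h w' i)) f] =
    [seq hull s w' | w' <- ws & sat (fun i => s (with_points h w' i)) f].
  by move: x2; rewrite E -catA; case: (sat _ f).
elim: ws wsd {IH x2} => //= w' ws IH /andP[/eqs[e1 e2] /IH{}IH].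
by rewrite e2; case: (sat _ f) => /=; rewrite IH // e1.
Qed.

End Machine.

(** * The algorithm *)

Section Algorithm.
Variable R : realType.
Notation pt := 'rV[R]_3.
Implicit Type e : nat -> R.

(* The first twelve variables are the coordinates of four points. *)
Definition hull_critical e := forall t1, forall t2, forall t3,
  critical (fun i => e (i + 12)%N)
    (e 0%N + t1 * (e 3 - e 0%N) + t2 * (e 6 - e 0%N) + t3 * (e 9 - e 0%N))
    (e 1%N + t1 * (e 4 - e 1%N) + t2 * (e 7 - e 1%N) + t3 * (e 10 - e 1%N))
    (e 2%N + t1 * (e 5 - e 2%N) + t2 * (e 8 - e 2%N) + t3 * (e 11 - e 2%N)).

Lemma SA_hull_critical : SA hull_critical.
Proof.
rewrite /hull_critical; do 3!apply: SA_all.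
by apply: SA_critical => [i|||]; sa.
Qed.

Lemma item_set_hull (s : nat -> R) (w : seq reg) (x : pt) :
  item_set (hull s w) x <-> affine_span (point s w 0)
    (fun i : 'I_3 => point s w i.+1 - point s w 0) x.
Proof.
rewrite /item_set /affine_span /=; split=> -[t ->]; exists t; congr (_ + _);
by apply: eq_bigr => -[[|[|[|//]]] ?] _.
Qed.

Lemma pointE (s : nat -> R) (w : seq reg) (k : nat) (j : 'I_3) :
  point s w k ord0 j = s (nth 0%N w (3 * k + j)).
Proof.
by rewrite /point mxE; case: j => [[|[|[|//]]] ?] /=; rewrite ?addn0 ?addn1 ?addn2.
Qed.

Lemma span3E (t : 'I_3 -> R) (b0 : pt) (b : 'I_3 -> pt) j :
  (b0 + \sum_(i < 3) t i *: (b i - b0)) ord0 j = b0 ord0 j +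
    t 0 * (b 0 ord0 j - b0 ord0 j) + t 1 * (b 1 ord0 j - b0 ord0 j) +
    t 2%:R * (b 2%:R ord0 j - b0 ord0 j).
Proof.
rewrite !big_ord_recl big_ord0 addr0 !mxE !addrA.
by congr (_ + t _ * (b _ _ _ - _) + t _ * (b _ _ _ - _) + t _ * (b _ _ _ - _));
  apply: val_inj.
Qed.

Lemma hull_criticalP (p : {mpoly R[3]}) (s : nat -> R) h w : (msize p <= 4)%N ->
  (forall i, (i < ncoef)%N -> s (h i) = input_regs p i) ->
  hull_critical (fun i => s (with_points h w i)) <->
  forall x, item_set (hull s w) x -> crit_set p x.
Proof.
move=> p4 sh; pose e i := s (with_points h w i).
have ee i : (i < ncoef)%N -> e (i + 12)%N = input_regs p i.
  by move=> i_lt; rewrite /e /with_points ltnNge leq_addl /= addnK sh.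
have crit3 (t : 'I_3 -> R) :
    crit_set p (point s w 0 + \sum_(i < 3) t i *: (point s w i.+1 - point s w 0)) <->
    critical (fun i => e (i + 12)%N)
      (e 0%N + t 0 * (e 3 - e 0%N) + t 1 * (e 6 - e 0%N) + t 2%:R * (e 9 - e 0%N))
      (e 1%N + t 0 * (e 4 - e 1%N) + t 1 * (e 7 - e 1%N) + t 2%:R * (e 10 - e 1%N))
      (e 2%N + t 0 * (e 5 - e 2%N) + t 1 * (e 8 - e 2%N) + t 2%:R * (e 11 - e 2%N)).
  rewrite (crit_set_critical _ p4 ee).
  by rewrite !(span3E t _ (fun i : 'I_3 => point s w i.+1)) !pointE.
split=> [hT x /item_set_hull[t ->]|hC t1 t2 t3]; first exact/crit3/hT.
pose t (i : 'I_3) := nth 0 [:: t1; t2; t3] i.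
apply: (iffLR (crit3 t)); apply: hC; apply/item_set_hull; by exists t.
Qed.

End Algorithm.

Theorem theorem4p14 (R : realType) :
  exists prog : cmd R,
    forall p : {mpoly R[3]}, (msize p <= 4)%N ->
      exists (s : regs R) (out : seq (out_item R)),
        [/\ exec prog (input_regs p, [::]) (s, out),
            (forall it, it \in out -> forall x, item_set it x -> crit_set p x) &
            (forall C, V_aff p C ->
               exists2 it, it \in out & forall x, C x <-> item_set it x)].
Proof.
(* Both formulas are obtained before [p] is given, so the program built from them is uniform in
   [p]. *)
have [fD hD] := SA_isolated_coordinate (@SA_critical R).
have [fT hT] := SA_hull_critical R.
(* Variables beyond the coefficients all read register [n], which keeps every index below the first
   free register [n.+1]. *)
pose n := ncoef; pose h i := minn i n; pose J := jobs (atoms fD).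
have hn i : (h i < n.+1)%N by rewrite ltnS geq_minr.
pose d := (n.+1 + size J)%N; pose ws := tuples 12 (iota n.+1 (size J)).
have hd i : (h i < d)%N by rewrite (leq_trans (hn i)) ?leq_addr.
have wsP w : w \in ws -> (size w == 12)%N && all (fun r => r < d)%N w.
  rewrite mem_tuples => /andP[-> wJ]; apply: sub_all wJ => r /=.
  by rewrite mem_iota => /andP[].
exists (CSeq (pool_prog h J n.+1) (emits_prog h fT d ws)) => p p4.
have [s1 [x1 a1 pool]] := exec_pool J (input_regs p) [::] hn.
have [s2 x2] := exec_emits (ws := ws) fT s1 [::] hd (introT allP wsP).
have hE i : (i < n)%N -> h i = i by move=> i_lt; apply/minn_idPl/ltnW.
have s1h i : (i < n)%N -> s1 (h i) = input_regs p i 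
  by move=> i_lt; rewrite hE //; apply: a1; apply: ltnW.
exists s2; eexists; split; first exact: ESeq x1 x2.
  move=> it /mapP[w]; rewrite mem_filter => /andP[satT _] ->.
  by apply/(hull_criticalP w p4 s1h)/hT.
move=> C aC; have [affC Ccrit _] := aC.
have [c [b0 [b [Cspan vb0 vb]]]] := affine_frame affC.
have regP v (j : 'I_3) : chart_vertex C c v ->
    exists2 r, r \in iota n.+1 (size J) & s1 r = v ord0 j.
  move=> hv; apply/pool/has_jobs/(isolated_coordinate_atoms hD).
  apply: (chart_vertex_coordinate (@SA_critical R) _ _ aC hv) => x.
  by apply: crit_set_critical => // i /hE->.
(* Entry [i] of the tuple is coordinate [i %% 3] of point [i %/ 3], where point 0 is [b0] and the
   next three are the values of [b]. *)
have /choice[r hr] : forall i : nat, exists r, r \in iota n.+1 (size J) /\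
    s1 r = (if i is k.+3 then b (inord (k %/ 3)) else b0) ord0 (inord (i %% 3)).
  move=> i; have [|r r1 r2] := @regP (if i is k.+3 then b (inord (k %/ 3)) else b0)
    (inord (i %% 3)); last by exists r.
  by case: i => [|[|[|k]]].
pose w := mkseq r 12.
have wws : w \in ws.
  rewrite mem_tuples size_mkseq eqxx; apply/allP => _ /mapP[i _ ->].
  by have [] := hr i.
have wE k (j : 'I_3) : (k < 4)%N -> point s1 w k ord0 j =
    (if k is l.+1 then b (inord l) else b0) ord0 j.
  move=> k4; rewrite pointE nth_mkseq; last first.
    apply: (@leq_trans (3 * k + 3)); first by rewrite ltn_add2l.
    by rewrite -mulnSr -[12%N]/(3 * 4)%N leq_mul2l.
  have [_ ->] := hr (3 * k + j)%N; rewrite mulnC modnMDl modn_small // inord_val.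
  case: k k4 => [|k] _; first by case: j => [[|[|[|//]]] ?].
  by rewrite mulSn -addnA /= divnMDl // divn_small // addn0.
have w0 : point s1 w 0 = b0 by apply/rowP => j; rewrite wE.
have wS (i : 'I_3) : point s1 w i.+1 = b i.
  apply/rowP => j; rewrite wE; first by rewrite [in LHS]inord_val.
  exact: (ltn_ord i).
have CE x : C x <-> item_set (hull s1 w) x.
  rewrite Cspan item_set_hull w0 /affine_span.
  split=> -[t ->]; exists t; congr (_ + _); apply: eq_bigr => i _; by rewrite wS.
exists (hull s1 w) => //; apply/mapP; exists w => //; rewrite mem_filter wws andbT.
by apply/hT/(hull_criticalP w p4 s1h) => x /CE/Ccrit.
Qed.
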